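(* Let $p\ge 1$ and $n\ge 2$ be integers. Then $L^2(\widehat{S}_p)$ is the direct sum of the Hilbert spaces $\mathcal{H}_m^p(\widehat{S}_p)$, $m=0,1,2,\dots$, that is, $$L^2(\widehat{S}_p)=\bigoplus_{m=0}^{\infty}\mathcal{H}_m^p(\widehat{S}_p).$$
   Context: $S$ is the Euclidean unit sphere in $\mathbb{R}^n\subset\mathbb{C}^n$ centred at the origin, $\sigma$ is the normalised surface measure on $S$ ($\sigma(S)=1$), and $\widehat{S}_p:=\bigcup_{k=0}^{p-1}e^{\frac{k\pi i}{p}}S\subset\mathbb{C}^n$, where $e^{i\varphi}S=\{e^{i\varphi}x: x\in S\}$. $\mathcal{H}_m^p(\mathbb{C}^n)$ is the space of complex polynomials $u$ on $\mathbb{C}^n$ that are homogeneous of degree $m$ and polyharmonic of order $p$, i.e. $\Delta^p u=0$ with $\Delta=\sum_{j=1}^n\partial^2/\partial x_j^2$. Spherical polyharmonics of degree $m$ and order $p$ are the elements of $\mathcal{H}_m^p(\widehat{S}_p):=\{u|_{\widehat{S}_p}: u\in\mathcal{H}_m^p(\mathbb{C}^n)\}$. $L^2(\widehat{S}_p)$ is the Hilbert space of square-integrable complex functions on $\widehat{S}_p$ with inner product $$\langle f,g\rangle_{\widehat{S}_p}:=\frac1p\int_S\sum_{j=0}^{p-1}f(e^{\frac{j\pi i}{p}}\zeta)\overline{g(e^{\frac{j\pi i}{p}}\zeta)}\,d\sigma(\zeta).$$ A Hilbert space $H$ is the direct sum of subspaces $H_m$, written $H=\bigoplus_{m=0}^\infty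 H_m$, if: (i) each $H_m$ is a closed subspace of $H$; (ii) $H_m$ is orthogonal to $H_k$ whenever $m\ne k$; (iii) for every $x\in H$ there exist $x_m\in H_m$ with $x=x_0+x_1+x_2+\cdots$, the sum converging in the norm of $H$. *)

(* Defs.v *)
(* MathComp / MathComp-Analysis *)
From HB Require Import structures.
From mathcomp Require Import all_boot all_order all_algebra.
(* the notations of mpoly clash with those of MathComp-Analysis *)
From mathcomp Require Import -(notations) mpoly.
From mathcomp Require Import complex.
From mathcomp Require Import all_classical all_reals all_analysis.
From mathcomp Require Import ring lra.

Set Implicit Arguments.
Unset Strict Implicit.
Unset Printing Implicit Defensive.

Import Order.TTheory GRing.Theory Num.Theory.
Import numFieldNormedType.Exports.

Local Open Scope classical_set_scope.
Local Open Scope ring_scope.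
Local Open Scope complex_scope.

Section euclidean.
Context {R : realType} {n : nat}.
Implicit Types x y : 'rV[R]_n.

(* The library norm on row vectors is the sup norm, hence this definition. *)
Definition enorm x : R := Num.sqrt (\sum_(i < n) x ord0 i ^+ 2).

Definition sphere : set 'rV[R]_n := [set x | enorm x = 1].

Lemma ler_norm_enorm x : `|x| <= enorm x.
Proof.
rewrite [leLHS]mx_normrE; apply/bigmax_leP; split; first exact: sqrtr_ge0.
move=> [i j] _ /=; rewrite ord1 -sqrtr_sqr ler_wsqrtr//.
by rewrite (bigD1 j)//= lerDl sumr_ge0// => k _; exact: sqr_ge0.
Qed.

Lemma closed_sphere : closed sphere.
Proof.
pose q (x : 'rV[R]_n) : R := \sum_(i < n) x ord0 i ^+ 2.
have cq : continuous q.
  apply: (@continuous_big R); first exact: (@add_continuous R).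
  move=> i _ x; apply: (@continuous_comp _ _ _ (fun z : 'rV[R]_n => z ord0 i) (fun r => r ^+ 2)).
    exact: coord_continuous.
  exact: exprn_continuous.
apply: (@preimage_closed _ _ enorm [set r | r = 1]); last exact: closed_eq.
move=> x _; apply: (@continuous_comp _ _ _ q (@Num.sqrt R)); first exact: cq.
exact: sqrt_continuous.
Qed.

End euclidean.

Arguments sphere R n : clear implicits.

Notation borel_rV R n := (g_sigma_algebraType (@open 'rV[R]_n)).

Lemma measurable_sphere {R : realType} {n : nat} :
  measurable (sphere R n : set (borel_rV R n)).
Proof.
rewrite -[X in measurable X]setCK; apply: measurableC.
by apply: sub_sigma_algebra; rewrite openC; exact: closed_sphere.
Qed.

Section caratheodory_exhaustion.
Local Open Scope ereal_scope.
Context {R : realType} {T : Type}.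
Variables (mu : {outer_measure set T -> \bar R}) (D : (set T)^nat).
Hypothesis D_nd : forall k, D k `<=` D k.+1.
Hypothesis D_sep : forall k A B, A `<=` D k -> B `<=` ~` D k.+1 ->
  mu A + mu B <= mu (A `|` B).

Lemma caratheodory_exhaustion : mu.-caratheodory (\bigcup_k D k).
Proof.
apply: le_caratheodory_measurable => X.
have [->|Xfin] := eqVneq (mu X) +oo; first exact: leey.
have muX_fin : mu X \is a fin_num.
  by rewrite ge0_fin_numE ?outer_measure_ge0// ltey.
have sub_fin A : A `<=` X -> mu A \is a fin_num.
  move=> AX; rewrite ge0_fin_numE ?outer_measure_ge0//.
  by rewrite (le_lt_trans (le_outer_measure mu _ _ AX))// ltey.
pose r k := X `&` (D k.+1 `\` D k).
pose a k := mu (X `&` D k).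
have a_le k : a k <= mu X by apply: le_outer_measure; exact: subIsetl.
have r_le k : a k + mu (r k.+1) <= a k.+2.
  apply: le_trans (D_sep _ _) _; first exact: subIsetr.
    by move=> x [_ []].
  apply: le_outer_measure => x [[Xx Dx]|[Xx [Dx _]]]; split => //.
  by apply/D_nd/D_nd.
have sum_le N : \sum_(0 <= k < N) mu (r k.+1) <= a N + a N.+1.
  elim: N => [|N IH]; first by rewrite big_nil adde_ge0// outer_measure_ge0.
  rewrite big_nat_recr//= (le_trans (leeD2r _ IH))//.
  by rewrite addeAC [leRHS]addeC leeD2r.
have sum_fin : \sum_(0 <= k <oo) mu (r k) < +oo.
  rewrite nneseries_recl//; last by move=> k _; exact: outer_measure_ge0.
  apply: (@le_lt_trans _ _ (mu X + (mu X + mu X))); last first.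
    by rewrite -ge0_fin_numE ?adde_ge0 ?outer_measure_ge0// !fin_numD muX_fin.
  apply: leeD; first by apply: le_outer_measure; exact: subIsetl.
  rewrite -(@nneseries_addn _ _ 1%N)//; last first.
    by move=> k; exact: outer_measure_ge0.
  apply: lime_le; first by apply: is_cvg_nneseries => k _ _; exact: outer_measure_ge0.
  apply: nearW => N; apply: le_trans (leeD (a_le N) (a_le N.+1)).
  by under eq_bigr do rewrite addn1; exact: sum_le.
have step N : mu (X `&` \bigcup_k D k) + mu (X `&` ~` \bigcup_k D k) <=
    mu X + \sum_(N <= k <oo) mu (r k).
  have XD : X `&` \bigcup_k D k `<=`
      (X `&` D N) `|` \bigcup_(k in ~` `I_N) r k.
    move=> x [Xx [k _ Dkx]].
    have [DNx|nDNx] := pselect (D N x); first by left.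
    right; have : exists m, D (N + m)%N x.
      exists k; elim: N {nDNx} => [|N IH]; first by rewrite add0n.
      by rewrite addSn; exact: D_nd.
    move=> /cid[m]; elim: m => [|m IH]; first by rewrite addn0.
    rewrite addnS => Dm1; have [/IH//|nDm] := pselect (D (N + m)%N x).
    by exists (N + m)%N => //=; apply/negP; rewrite -leqNgt leq_addr.
  apply: (@le_trans _ _ (a N + \sum_(N <= k <oo) mu (r k) +
      mu (X `&` ~` \bigcup_k D k))).
    apply: leeD2r; apply: le_trans (le_outer_measure mu _ _ XD) _.
    apply: le_trans (outer_measureU2 _ _ _) _; apply: leeD2l.
    exact: outer_measure_sigma_subadditive_tail.
  rewrite addeAC leeD2r//; apply: le_trans (D_sep (k := N) _ _) _.
  - exact: subIsetr.
  - by move=> x [_ nDx] DSx; apply: nDx; exists N.+1.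
  - by apply: le_outer_measure => x [] [].
have tail := nneseries_tail_cvg sum_fin (fun k _ => outer_measure_ge0 mu (r k)).
have : (mu X + \sum_(N <= k <oo) mu (r k)) @[N --> \oo] --> mu X + 0.
  by apply: cvgeD => //; [rewrite fin_num_adde_defl|exact: cvg_cst].
rewrite adde0 => /cvg_lim <-//.
apply: lime_ge; last exact: nearW.
apply: cvgP; apply: cvgeD tail; last exact: cvg_cst.
by rewrite fin_num_adde_defl.
Qed.

End caratheodory_exhaustion.

Section hausdorff.
Local Open Scope ereal_scope.
Context {R : realType} {n : nat}.
Variable s : nat.
Implicit Types (A B U : set 'rV[R]_n) (d : R).

(* The s-th power of the Euclidean diameter of U; the point 0 makes the value
   on the empty set 0, also when s = 0. *)
Definition diamX U : \bar R :=
  ereal_sup (0 |` [set ((enorm (x.1 - x.2) ^+ s)%R)%:E | x in U `*` U]).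

Definition diam_le d U := forall x y, U x -> U y -> (enorm (x - y) <= d)%R.

Definition hausdorff_cover d A :=
  [set U : (set 'rV[R]_n)^nat |
    A `<=` \bigcup_k U k /\ forall k, diam_le d (U k)].

Definition hausdorff_pre d A : \bar R :=
  ereal_inf [set \sum_(k <oo) diamX (U k) | U in hausdorff_cover d A].

(* The usual normalising constant is omitted: it cancels in the normalisation
   of the surface measure below. *)
Definition hausdorff (A : set (borel_rV R n)) : \bar R :=
  ereal_sup [set hausdorff_pre d A | d in [set d : R | (0 < d)%R]].

Lemma diamX_ge0 U : 0 <= diamX U.
Proof. by apply: ereal_sup_ubound; left. Qed.

Lemma diamX0 : diamX set0 = 0.
Proof.
apply/eqP; rewrite eq_le diamX_ge0 andbT; apply: ge_ereal_sup => y.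
by move=> [->//|[x [[]]]].
Qed.

Lemma hausdorff_pre_ge0 d A : 0 <= hausdorff_pre d A.
Proof.
by apply: le_ereal_inf_tmp => _ [U _ <-]; apply: nneseries_ge0 => *;
  exact: diamX_ge0.
Qed.

Lemma hausdorff_pre_le d A : (0 < d)%R -> hausdorff_pre d A <= hausdorff A.
Proof. by move=> d0; apply: ereal_sup_ubound; exists d. Qed.

Lemma hausdorff_preS d d' A : (d' <= d)%R ->
  hausdorff_pre d A <= hausdorff_pre d' A.
Proof.
move=> dd; apply: ereal_inf_le_tmp => _ [U [AU dU] <-]; exists U => //.
by split => // k x y Ux Uy; exact: le_trans (dU k x y Ux Uy) dd.
Qed.

Lemma hausdorff_pre_sigma_subadditive d : sigma_subadditive (hausdorff_pre d).
Proof.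
pose T := g_sigma_algebraType (@setT (set 'rV[R]_n)).
pose g (U : set T) := if `[< diam_le d U >] then diamX U else +oo.
have g_ge0 U : 0 <= g U by rewrite /g; case: ifP => // _; exact: diamX_ge0.
have g0 : g set0 = 0.
  rewrite /g; case: asboolP => [_|]; first exact: diamX0.
  by case=> x y [].
suff preE : hausdorff_pre d = mu_ext g.
  rewrite preE => F; exact: (@mu_ext_sigma_subadditive _ T R g g_ge0 F).
apply/funext => A; apply/eqP; rewrite eq_le; apply/andP; split.
- apply: le_ereal_inf_tmp => _ [U [_ AU] <-].
  have [dU|] := pselect (forall k, diam_le d (U k)).
    apply: ereal_inf_lbound; exists U => //; apply: eq_eseriesr => k _.
    by rewrite /g asboolT.
  move/existsNP => [k ndUk]; rewrite [leRHS](@eseries_pinfty _ _ _ k) ?leey//.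
    by move=> i _; rewrite -ltNye (lt_le_trans _ (g_ge0 _)).
  by rewrite /g asboolF.
- apply: ereal_inf_le_tmp => _ [U [AU dU] <-]; exists U.
    by split => // k; exact: sub_sigma_algebra.
  by apply: eq_eseriesr => k _; rewrite /g asboolT.
Qed.

Lemma hausdorff0 : hausdorff set0 = 0.
Proof.
apply/eqP; rewrite eq_le; apply/andP; split.
  apply: ge_ereal_sup => _ [d _ <-]; apply: ereal_inf_lbound.
  exists (fun=> set0); last by rewrite eseries0// => *; exact: diamX0.
  by split => // k x y [].
exact: le_trans (hausdorff_pre_ge0 1 _) (hausdorff_pre_le _ ltr01).
Qed.

Lemma hausdorff_ge0 A : 0 <= hausdorff A.
Proof. exact: le_trans (hausdorff_pre_ge0 1 _) (hausdorff_pre_le _ ltr01). Qed.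

Lemma le_hausdorff : {homo hausdorff : A B / A `<=` B >-> A <= B}.
Proof.
move=> A B AB; apply: ge_ereal_sup => _ [d d0 <-].
apply: le_trans (hausdorff_pre_le _ d0); apply: ereal_inf_le_tmp.
by move=> _ [U [BU dU] <-]; exists U => //; split => //; exact: subset_trans BU.
Qed.

Lemma hausdorff_sigma_subadditive : sigma_subadditive hausdorff.
Proof.
move=> F; apply: ge_ereal_sup => _ [d d0 <-].
apply: le_trans (hausdorff_pre_sigma_subadditive _ _) _.
by apply: lee_nneseries => k *; [exact: hausdorff_pre_ge0|exact: hausdorff_pre_le].
Qed.

HB.instance Definition _ := isOuterMeasure.Build R 'rV[R]_n hausdorff
  hausdorff0 hausdorff_ge0 le_hausdorff hausdorff_sigma_subadditive.

Lemma hausdorff_metric (e : R) A B : (0 < e)%R ->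
  (forall x y, A x -> B y -> (e < enorm (x - y))%R) ->
  hausdorff A + hausdorff B <= hausdorff (A `|` B).
Proof.
move=> e0 sepAB.
suff pre_le d d' : (0 < d)%R -> (0 < d')%R ->
    hausdorff_pre d A + hausdorff_pre d' B <= hausdorff (A `|` B).
  have := hausdorff_ge0 (A `|` B).
  case: (hausdorff (A `|` B)) pre_le => [r pre_le _|_ _|_];
    [|exact: leey|by rewrite leeNy_eq].
  have preB d' : (0 < d')%R -> hausdorff_pre d' B \is a fin_num.
    move=> d'0; rewrite ge0_fin_numE ?hausdorff_pre_ge0//.
    apply: le_lt_trans (ltry r); apply: le_trans (pre_le 1%R d' ltr01 d'0).
    by rewrite leeDr// hausdorff_pre_ge0.
  have hA d' : (0 < d')%R -> hausdorff A <= r%:E - hausdorff_pre d' B.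
    move=> d'0; apply: ge_ereal_sup => _ [d d0 <-].
    by rewrite leeBrDr ?preB// pre_le.
  have finA : hausdorff A \is a fin_num.
    rewrite ge0_fin_numE ?hausdorff_ge0//; apply: le_lt_trans (hA _ ltr01) _.
    by rewrite -(fineK (preB _ ltr01)) -EFinB ltry.
  rewrite addeC -leeBrDr//; apply: ge_ereal_sup => _ [d' d'0 <-].
  by rewrite leeBrDr// addeC -leeBrDr ?preB// hA.
move=> d0 d'0; pose m := Num.min e (Num.min d d').
have m0 : (0 < m)%R by rewrite !lt_min e0 d0.
have [md md'] : (m <= d)%R /\ (m <= d')%R.
  by split; rewrite !ge_min lexx ?orbT.
apply: le_trans (leeD (hausdorff_preS _ md) (hausdorff_preS _ md')) _.
apply: le_trans (hausdorff_pre_le _ m0).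
apply: le_ereal_inf_tmp => _ [U [ABU dU] <-].
pose V C k := if `[< U k `&` C !=set0 >] then U k else set0.
have coverV C : C `<=` A `|` B -> hausdorff_cover m C (V C).
  move=> CAB; split.
    move=> x Cx; have [k _ Ukx] := ABU x (CAB x Cx); exists k => //.
    by rewrite /V asboolT//; exists x.
  by move=> k; rewrite /V; case: ifP => _; [exact: dU|move=> x y []].
apply: (@le_trans _ _ (\sum_(k <oo) diamX (V A k) + \sum_(k <oo) diamX (V B k))).
  apply: leeD; apply: ereal_inf_lbound.
    by exists (V A) => //; apply: coverV; exact: subsetUl.
  by exists (V B) => //; apply: coverV; exact: subsetUr.
rewrite -nneseriesD; try by move=> *; exact: diamX_ge0.
apply: lee_nneseries => k *; first by rewrite adde_ge0 ?diamX_ge0.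
rewrite /V; case: asboolP => [[x [Ux Ax]]|_]; last first.
  by rewrite diamX0 add0e; case: ifP => _; rewrite ?diamX0 ?diamX_ge0.
case: asboolP => [[y [Uy By]]|_]; last by rewrite diamX0 adde0.
have := lt_le_trans (sepAB x y Ax By) (dU k x y Ux Uy).
by rewrite ltNge ge_min lexx.
Qed.

Lemma open_caratheodory (O : set 'rV[R]_n) : open O ->
  hausdorff.-caratheodory O.
Proof.
move=> oO.
pose D k := [set x : 'rV[R]_n | forall y, ~ O y -> (k.+1%:R^-1 <= `|x - y|)%R].
have -> : O = \bigcup_k D k.
  apply/seteqP; split => x.
    move=> Ox; have /nbhs_ballP[e /= e0 eO] := open_nbhs_nbhs (conj oO Ox).
    have [k ke] := ltr_add_invr (e0 : 0 < e)%R; rewrite add0r in ke.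
    exists k => // y nOy; rewrite leNgt; apply/negP => xy; apply: nOy; apply: eO.
    by rewrite -ball_normE /ball_/= (lt_trans xy).
  move=> [k _ Dkx]; apply: contrapT => /Dkx.
  by rewrite subrr normr0 leNgt invr_gt0 ltr0n.
apply: caratheodory_exhaustion => [k x Dkx y /Dkx|k A B AD BD].
  by apply: le_trans; rewrite lef_pV2 ?posrE ?ltr0n// ler_nat.
pose e : R := (k.+1%:R^-1 - k.+2%:R^-1)%R.
have e0 : (0 < e)%R by rewrite subr_gt0 ltf_pV2 ?posrE ?ltr0n// ltr_nat.
apply: (hausdorff_metric e0) => x y Ax By.
have /existsNP[z /not_implyP[nOz /negP]] := BD y By; rewrite -ltNge => yz.
rewrite (lt_le_trans _ (ler_norm_enorm _))// ltrBlDr.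
apply: le_lt_trans (AD x Ax z nOz) _.
by rewrite -(subrKA y) (le_lt_trans (ler_normD _ _))// ltrD2l.
Qed.

Lemma measurable_caratheodory (A : set (borel_rV R n)) : measurable A ->
  hausdorff.-cara.-measurable A.
Proof.
apply: smallest_sub => [|O oO]; first exact: sigma_algebra_measurable.
exact: open_caratheodory.
Qed.

Lemma hausdorff_sigma_additive : semi_sigma_additive hausdorff.
Proof.
move=> F mF tF mUF.
apply: (@caratheodory_measure_sigma_additive _ _ hausdorff) => //.
  by move=> k; exact: measurable_caratheodory.
exact: measurable_caratheodory.
Qed.

HB.instance Definition _ := isMeasure.Build _ _ _ hausdorff
  hausdorff0 hausdorff_ge0 hausdorff_sigma_additive.

End hausdorff.

Section surface.
Context (R : realType) (n : nat).

Lemma sphere_area_inv_ge0 : 0 <= (fine (hausdorff n.-1 (sphere R n)))^-1.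
Proof. by rewrite invr_ge0 fine_ge0// hausdorff_ge0. Qed.

(* Surface area on the sphere is (n-1)-dimensional Hausdorff measure, which is
   positive and finite there when n >= 1. The normalised measure is taken as a
   Borel measure on R^n carried by the sphere. *)
Definition surface_measure : {measure set (borel_rV R n) -> \bar R} :=
  mscale (NngNum sphere_area_inv_ge0)
    (mrestr (hausdorff n.-1) (@measurable_sphere R n)).

End surface.

Section polyharmonic.
Context (R : realType) (n : nat).
Local Notation C := R[i].

Definition laplacian (u : mpoly n C) : mpoly n C :=
  \sum_(j < n) mderiv j (mderiv j u).

(* Homogeneous of degree m (the zero polynomial included) and polyharmonic of
   order p. *)
Definition polyharmonic (p m : nat) : set (mpoly n C) :=
  [set u | u \is ishomog1 m mdeg /\ iter p laplacian u = 0].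

End polyharmonic.

Section spherical.
Context (R : realType) (n p : nat).
Local Notation C := R[i].
Implicit Types f g : 'rV[C]_n -> C.

Definition expi (t : R) : C := cos t +i* sin t.

(* e^(k pi i / p) x, for a real vector x *)
Definition phase (k : nat) (x : 'rV[R]_n) : 'rV[C]_n :=
  expi (k%:R * pi / p%:R) *: map_mx (real_complex R) x.

Definition rotated_spheres : set 'rV[C]_n :=
  \bigcup_(k in `I_p) (phase k @` sphere R n).

(* A function on rotated_spheres is represented by a total function on C^n,
   whose values outside rotated_spheres are irrelevant: everything below only
   depends on the restriction. *)
Definition spherical_polyharmonic (m : nat) : set ('rV[C]_n -> C) :=
  [set f | exists2 u, polyharmonic p m u &
    forall z, rotated_spheres z -> f z = meval (fun j => z ord0 j) u].

Definition sphere_integral (h : 'rV[R]_n -> C) : C :=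
  Rintegral (surface_measure R n) (sphere R n) (fun x => complex.Re (h x)) +i*
  Rintegral (surface_measure R n) (sphere R n) (fun x => complex.Im (h x)).

(* The p rotated copies of the sphere are disjoint and closed, so that f is
   measurable iff it is so on each of them. *)
Definition L2 : set ('rV[C]_n -> C) :=
  [set f : 'rV[C]_n -> C |
    (forall k, (k < p)%N ->
      measurable_fun (sphere R n : set (borel_rV R n))
        (fun x => complex.Re (f (phase k x))) /\
      measurable_fun (sphere R n : set (borel_rV R n))
        (fun x => complex.Im (f (phase k x)))) /\
    (\int[surface_measure R n]_(x in sphere R n)
      (\sum_(k < p) complex.Re `|f (phase k x)| ^+ 2)%:E < +oo)%E].

Definition L2_inner f g : C :=
  p%:R^-1 * sphere_integral
    (fun x => \sum_(k < p) f (phase k x) * (g (phase k x))^*).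

(* equality in the space L^2: almost everywhere on rotated_spheres *)
Definition L2_eq f g : Prop :=
  {ae surface_measure R n, forall x, sphere R n x ->
    forall k, (k < p)%N -> f (phase k x) = g (phase k x)}.

End spherical.

(* A Hilbert space is presented by a set H of elements of a vector space V,
   identified along eqH, with inner product ip; likewise a subspace is presented
   by a set of representatives, whence eqH in the definition of closedness. *)
Section hilbert.
Context (R : realType) (V : lmodType R[i]).
Variables (H : set V) (eqH : V -> V -> Prop) (ip : V -> V -> R[i]).

Definition hnorm (x : V) : R := Num.sqrt (complex.Re (ip x x)).

Definition closed_subspace (W : set V) : Prop :=
  [/\ W `<=` H,
      W 0,
      (forall (a : R[i]) (x y : V), W x -> W y -> W (a *: x + y)) &
      forall (w : nat -> V) (x : V), (forall k, W (w k)) -> H x ->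
        hnorm (w k - x) @[k --> \oo] --> 0 ->
        exists2 y, W y & eqH x y].

Definition orthogonal_sets (W W' : set V) : Prop :=
  forall x y, W x -> W' y -> ip x y = 0.

Definition hilbert_direct_sum (Hm : nat -> set V) : Prop :=
  [/\ forall m, closed_subspace (Hm m),
      forall m k, m <> k -> orthogonal_sets (Hm m) (Hm k) &
      forall x, H x -> exists2 xs : nat -> V, forall m, Hm m (xs m) &
        hnorm (x - \sum_(0 <= m < N) xs m) @[N --> \oo] --> 0].

End hilbert.

(* Main.v *)
Require Import Defs.
From HB Require Import structures.
From mathcomp Require Import all_boot all_order all_algebra.
From mathcomp Require Import -(notations) mpoly.
From mathcomp Require Import complex.
From mathcomp Require Import all_classical all_reals all_analysis.
From mathcomp Require Import measurable_realfun.
From mathcomp Require Import ring lra zify.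

(** Write S for the unit sphere, zeta for exp (i pi / p), so that the rotated
    spheres are the zeta^j S with j < p, and H_m for the spherical
    polyharmonics of degree m.

    Closedness, and the components of a function, come from orthogonal
    projections. Each H_m is finite-dimensional, so projections on it exist
    ([proj_exists]), and a space with projections is closed. If the H_m are
    orthogonal to each other and the sums of their elements are dense, the
    projections of a function on the H_m add up to it ([direct_sum_criterion]).

    Orthogonality. Let u and v have degrees m > k. As they are homogeneous,
    their inner product is a multiple of the integral over S of u times the
    conjugate of v, by the factor sum_j zeta^((m - k) j). The integral vanishes
    if m - k is odd, by the antipodal symmetry, and the factor vanishes if m -
    k is even and less than 2 p. If m - k >= 2 p, Almansi's theorem ([almansi])
    writes u as the sum of the |x|^(2 i) h_i with i < p and h_i harmonic of
    degree m - 2 i, and v likewise, so that on S all degrees that occur for u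
    exceed those for v. It remains that harmonic polynomials of distinct
    degrees are orthogonal on S ([harmonic_orthogonal]): the sum of the squares
    of the infinitesimal rotations x_i d_j - x_j d_i is symmetric for the
    surface measure, and acts on harmonic polynomials of degree d as a scalar
    that depends injectively on d. Symmetry holds because the integral of a
    derivative along rotations is 0, and this follows from the invariance of
    Hausdorff measure under isometries.

    Density. By the same theorem every homogeneous polynomial is a sum of terms
    |x|^(2 j) h with h harmonic. The p-th power of z.z is 1 on the rotated
    spheres, so there j can be replaced by its remainder modulo p, which leaves
    a polyharmonic polynomial of order p. Hence all polynomials restrict to
    finite sums of elements of the H_m ([spherical_span_ceval]). A function on
    the rotated spheres amounts to p functions on S. The indicators of the
    spheres are polynomials in z.z ([piece]), so it suffices to approximate on
    S ([glue_polynomials]). Polynomials are dense in the square-integrable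
    functions on S by a general fact on algebras of bounded functions that
    generate the sigma-algebra ([algebra_dense_L2]): explicit polynomials in
    one variable approximate a step, so indicators of half-spaces can be
    approximated, then those of all Borel sets, then simple functions. *)

Set Implicit Arguments.
Unset Strict Implicit.
Unset Printing Implicit Defensive.

Import Order.TTheory GRing.Theory Num.Theory.
Import numFieldNormedType.Exports.

Local Open Scope classical_set_scope.
Local Open Scope ring_scope.
Local Open Scope complex_scope.

(** * Harmonic and polyharmonic polynomials *)

(** Sums over all pairs (i, j) of the expansion of the square of x_i d_j - x_j
    d_i applied to u: here A i j stands for x_i^2 d_j^2 u, D i j for x_i x_j
    d_i d_j u, and B i for x_i d_i u. *)
Lemma sum_casimir (V : pzRingType) n (A D : 'I_n -> 'I_n -> V) (B : 'I_n -> V) :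
  \sum_i \sum_j (A i j + A j i - D i j *+ 2 - B i - B j
    + ((i == j)%:R * B j) *+ 2) =
  (\sum_i \sum_j A i j) *+ 2 - (\sum_i \sum_j D i j) *+ 2
    - (\sum_i B i) *+ n - (\sum_i B i) *+ n + (\sum_i B i) *+ 2.
Proof.
have sumB : \sum_(i < n) \sum_(j < n) B j = (\sum_i B i) *+ n.
  by rewrite sumr_const card_ord.
have sumB' : \sum_(i < n) \sum_(j < n) B i = (\sum_i B i) *+ n.
  by rewrite exchange_big.
have sumA : \sum_(i < n) \sum_(j < n) A j i = \sum_i \sum_j A i j.
  exact: exchange_big.
have sumd : \sum_(i < n) \sum_(j < n) (i == j)%:R * B j = \sum_i B i.
  apply: eq_bigr => i _; rewrite (bigD1 i)//= eqxx mul1r big1 ?addr0// => j ji.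
  by rewrite eq_sym (negbTE ji) mul0r.
transitivity (\sum_i (\sum_j A i j + \sum_j A j i - (\sum_j D i j) *+ 2
    - \sum_(j < n) B i - \sum_j B j + (\sum_j (i == j)%:R * B j) *+ 2)).
  by apply: eq_bigr => i _; rewrite !big_split/= !sumrN !sumrMnl.
rewrite !big_split/= !sumrN !sumrMnl sumA sumB sumB' sumd.
by rewrite mulr2n.
Qed.

(** One such square: x and y stand for x_i and x_j, f and g for d_j u and d_i
    u, and a, b, c for d_j^2 u, d_i^2 u and d_i d_j u. The coefficients 0 and 1
    are the values of the d_k x_l. *)
Lemma casimir_offdiag (V : comPzRingType) (x y a b c f g : V) :
  x * (0 * f + x * a - (1 * g + y * c)) - y * (1 * f + x * c - (0 * g + y * b)) =
  x ^+ 2 * a + y ^+ 2 * b - x * y * c *+ 2 - x * g - y * f + 0 * (y * f) *+ 2.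
Proof. ring. Qed.

Lemma casimir_diag (V : comPzRingType) (x a f : V) :
  x * (1 * f + x * a - (1 * f + x * a)) - x * (1 * f + x * a - (1 * f + x * a)) =
  x ^+ 2 * a + x ^+ 2 * a - x * x * a *+ 2 - x * f - x * f + 1 * (x * f) *+ 2.
Proof. ring. Qed.

Lemma casimir_scalar (K : comPzRingType) (V : lmodType K) (a u : V) (d : K) n :
  a *+ 2 - ((d * d) *: u - d *: u) *+ 2 - d *: u *+ n - d *: u *+ n
    + d *: u *+ 2 =
  2%:R *: (a - (d * (d + n%:R - 2)) *: u).
Proof.
rewrite -scalerBl !scalerMnl scalerBr scaler_nat scalerA -!addrA; congr (_ + _).
rewrite -[d *+ n]mulr_natr -!scaleNr -!scalerDl.
by congr (_ + _ *: _); ring.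
Qed.

Section algebra.
Context (R : realType) (n : nat).
Local Notation C := R[i].
Local Notation P := (mpoly n C).
Local Notation homog d u := (u \is ishomog1 d mdeg).
Implicit Types (u v h : P).

Definition varX (i : 'I_n) : P := mpolyX C (mnm1 i).
Definition sqnorm : P := \sum_i varX i ^+ 2.
Definition euler u : P := \sum_i varX i * mderiv i u.
(** The derivative at the identity of u under rotations of the plane of the
    coordinates i and j. *)
Definition rotgen i j u : P := varX i * mderiv j u - varX j * mderiv i u.

Lemma mderiv_varX i j : mderiv i (varX j) = (i == j)%:R.
Proof.
rewrite mderivX mnm1E eq_sym; case: eqP => [->|_]; last by rewrite scale0r.
by rewrite scale1r -[X in mnm_sub X _]add0m addmK mpolyX0.
Qed.

Lemma homog_varX i : homog 1 (varX i).
Proof. by rewrite dhomogX /= mdeg1. Qed.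

Lemma homog_sqnorm : homog 2 sqnorm.
Proof.
by apply: rpred_sum => i _; rewrite -[2%N]mul1n dhomogMn ?homog_varX.
Qed.

Lemma homog_mderiv d i u : homog d u -> homog d.-1 (mderiv i u).
Proof.
move=> hu; apply/dhomogP => m; rewrite mcoeff_msupp mcoeff_mderiv => mu.
have : mdeg (mnm_add m (mnm1 i)) = d.
  apply: (dhomog_mf hu); rewrite mcoeff_msupp.
  by apply: contraNneq mu => ->; rewrite mul0rn.
by rewrite mdegD mdeg1 addn1 => <-.
Qed.

Lemma mderiv_homog0 i u : homog 0 u -> mderiv i u = 0.
Proof.
move=> hu; apply/mpolyP => m; rewrite mcoeff_mderiv mcoeff0.
by rewrite (dhomog_nemf_coeff hu) ?mul0rn//= mdegD mdeg1 addn1.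
Qed.

(** Euler's identity; it suffices to check it on monomials. *)
Lemma eulerE d u : homog d u -> euler u = d%:R *: u.
Proof.
move=> hu; rewrite {1 2}(mpolyE u) /euler.
under eq_bigr => i _ do rewrite linear_sum/= mulr_sumr.
rewrite exchange_big scaler_sumr /=; apply: eq_big_seq => m mu.
rewrite -(dhomog_mf hu mu) /= mdegE natr_sum scaler_suml.
apply: eq_bigr => i _; rewrite mderivZ mderivX -!scalerAr scalerA.
rewrite [in RHS]scalerA [in RHS]mulrC.
have [->|m0] := eqVneq (m i) 0%N; first by rewrite mulr0 !scale0r.
rewrite -mpolyXD addmC submK//; apply/mnm_lepP => k; rewrite mnm1E.
by case: eqP => // <-; rewrite lt0n.
Qed.

Lemma laplacian_is_linear : linear (@laplacian R n).
Proof.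
move=> a u v; rewrite /laplacian scaler_sumr -big_split /=.
by apply: eq_bigr => i _; rewrite !linearP.
Qed.
HB.instance Definition _ := GRing.isLinear.Build C P P _ (@laplacian R n)
  laplacian_is_linear.

Lemma homog_laplacian d u : homog d u -> homog (d - 2) (laplacian u).
Proof.
move=> hu; apply: rpred_sum => i _; rewrite subn2.
by do 2! apply: homog_mderiv.
Qed.

Lemma laplacian_homog_lt2 d u : (d < 2)%N -> homog d u -> laplacian u = 0.
Proof.
move=> d2 hu; apply: big1 => i _; apply: mderiv_homog0.
by case: d d2 hu => [|[]]// _ /(homog_mderiv i).
Qed.

Lemma iter_laplacian0 k : iter k (@laplacian R n) 0 = 0.
Proof. by elim: k => //= k ->; rewrite linear0. Qed.

Lemma homog_iter_laplacian k d u : homog d u -> (d < 2 * k)%N ->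
  iter k (@laplacian R n) u = 0.
Proof.
elim: k d u => [|k IH] d u hu dk; first by rewrite muln0 in dk.
rewrite iterSr; have [d2|d2] := ltnP d 2.
  by rewrite (laplacian_homog_lt2 d2 hu) iter_laplacian0.
by apply: (IH _ _ (homog_laplacian hu)); lia.
Qed.

Lemma iter_laplacianZ k (a : C) u :
  iter k (@laplacian R n) (a *: u) = a *: iter k (@laplacian R n) u.
Proof. by elim: k => //= k ->; rewrite linearZ. Qed.

Lemma iter_laplacianD k u v : iter k (@laplacian R n) (u + v) =
  iter k (@laplacian R n) u + iter k (@laplacian R n) v.
Proof. by elim: k => //= k ->; rewrite linearD. Qed.

Lemma mderiv_sqnorm i : mderiv i sqnorm = varX i *+ 2.
Proof.
rewrite linear_sum (bigD1 i)//= big1 ?addr0 => [|j ji].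
  by rewrite expr2 mderivM mderiv_varX eqxx mul1r mulr1.
by rewrite expr2 mderivM mderiv_varX eq_sym (negbTE ji) mul0r mulr0 addr0.
Qed.

Lemma laplacian_sqnormM u :
  laplacian (sqnorm * u) = u *+ (2 * n) + euler u *+ 4 + sqnorm * laplacian u.
Proof.
rewrite /laplacian /euler -sumrMnl mulr_sumr mulrnA.
have -> : u *+ 2 *+ n = \sum_(i < n) u *+ 2 by rewrite sumr_const card_ord.
rewrite -!big_split /=; apply: eq_bigr => i _.
rewrite mderivM linearD/= !mderivM mderiv_sqnorm linearMn/= mderiv_varX eqxx /=.
by ring.
Qed.

(** The factor that the Laplacian brings out of |x|^(2j) h for h harmonic of
    degree d: it obeys c_(j+1) = c_j + 2 n + 4 (d + 2 j). The predecessor only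
    truncates at j = 0, where the product vanishes anyway. *)
Definition almansi_coef d j : nat := (j * (2 * (n + 2 * d) + 4 * j.-1))%N.

Lemma laplacian_sqnormX d j h : homog d h -> laplacian h = 0 ->
  laplacian (sqnorm ^+ j * h) =
  (almansi_coef d j)%:R *: (sqnorm ^+ j.-1 * h).
Proof.
move=> hh h0; elim: j => [|j IH]; first by rewrite mul1r h0 scale0r.
rewrite exprS -mulrA laplacian_sqnormM IH.
have hj : homog (2 * j + d) (sqnorm ^+ j * h).
  by apply: dhomogM => //; exact/dhomogMn/homog_sqnorm.
rewrite (eulerE hj) -(scaler_nat (2 * n)) -(scaler_nat 4) scalerA -scalerAr /=.
have -> : (almansi_coef d j)%:R *: (sqnorm * (sqnorm ^+ j.-1 * h)) =
    (almansi_coef d j)%:R *: (sqnorm ^+ j * h) :> P.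
  by case: j {IH hj} => [|j]; [rewrite !scale0r|rewrite mulrA -exprS].
rewrite -natrM -!scalerDl -!natrD; congr (_%:R *: _).
rewrite /almansi_coef; case: j {IH hj} => [|j] /=; nia.
Qed.

Lemma almansi_coef_neq0 d j : (0 < n)%N -> (almansi_coef d j.+1)%:R != 0 :> C.
Proof. by move=> n0; rewrite pnatr_eq0 /almansi_coef; lia. Qed.

Lemma iter_laplacian_sqnormX d h k j : homog d h -> laplacian h = 0 ->
  (j < k)%N -> iter k (@laplacian R n) (sqnorm ^+ j * h) = 0.
Proof.
move=> hh h0; elim: k j => [|k IH] j; first by rewrite ltn0.
case: j => [|j] jk; rewrite iterSr.
  by rewrite mul1r h0 iter_laplacian0.
by rewrite (laplacian_sqnormX _ hh h0) iter_laplacianZ IH ?scaler0.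
Qed.

(** The decomposition of Almansi, by induction on k: decompose the Laplacian of
    u, and divide the terms by the nonzero factors [almansi_coef] to get a
    polynomial with the same Laplacian. What remains of u is the harmonic term.
    The last clause makes up for the truncated degree d - 2 j. *)
Lemma almansi k d u : (0 < n)%N -> homog d u -> iter k (@laplacian R n) u = 0 ->
  exists h : nat -> P,
    (forall j, [/\ homog (d - 2 * j) (h j), laplacian (h j) = 0 &
                   (d < 2 * j)%N -> h j = 0]) /\
    u = \sum_(j < k) sqnorm ^+ j * h j.
Proof.
move=> n0; elim: k d u => [|k IH] d u hu.
  move=> /= ->; exists (fun=> 0); split; last by rewrite big_ord0.
  by move=> j; rewrite linear0 dhomog0.
rewrite iterSr => uk; have [d2|d2] := ltnP d 2.
  exists (fun j => if j == 0%N then u else 0); split.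
    move=> [|j] /=; first by rewrite subn0 (laplacian_homog_lt2 d2 hu).
    by rewrite linear0 dhomog0.
  by rewrite big_ord_recl big1 ?addr0 ?mul1r// => j _; rewrite mulr0.
have [g [hg gE]] := IH _ _ (homog_laplacian hu) uk.
(* sqnorm^(j+1) * q j has Laplacian sqnorm^j * g j *)
pose q j : P := ((almansi_coef (d - 2 - 2 * j) j.+1)%:R)^-1 *: g j.
pose w : P := \sum_(j < k) sqnorm ^+ j.+1 * q j.
have hq j : [/\ homog (d - 2 * j.+1) (q j), laplacian (q j) = 0 &
    (d < 2 * j.+1)%N -> q j = 0].
  have [hgj gj0 gjd] := hg j; split.
  - by rewrite (_ : d - 2 * j.+1 = d - 2 - 2 * j)%N ?dhomogZ//; lia.
  - by rewrite linearZ/= gj0 scaler0.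
  - by move=> dj; rewrite /q gjd ?scaler0//; lia.
have hw : homog d w.
  apply: rpred_sum => j _; have [hqj _ qjd] := hq j.
  have [dj|dj] := ltnP d (2 * j.+1); first by rewrite qjd// mulr0 dhomog0.
  suff: homog (2 * j.+1 + (d - 2 * j.+1)) (sqnorm ^+ j.+1 * q j).
    by rewrite subnKC.
  by apply: dhomogM => //; exact/dhomogMn/homog_sqnorm.
have Dw : laplacian w = laplacian u.
  rewrite gE linear_sum; apply: eq_bigr => j _ /=.
  have [hgj gj0 _] := hg j; rewrite -scalerAr linearZ/=.
  rewrite (laplacian_sqnormX _ hgj gj0) scalerA mulVf ?scale1r//.
  exact: almansi_coef_neq0.
exists (fun j => if j is j'.+1 then q j' else u - w); split.
  move=> [|j]; last exact: hq.
  rewrite muln0 subn0; split; [exact: rpredB| |by rewrite ltn0].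
  by rewrite linearB/= Dw subrr.
by rewrite big_ord_recl mul1r /= subrK.
Qed.

(** * Infinitesimal rotations *)

Lemma rotgen_is_linear i j : linear (rotgen i j).
Proof.
move=> a u v; rewrite /rotgen !linearP/= !mulrDr -!scalerAr scalerBr.
by rewrite opprD addrACA.
Qed.
HB.instance Definition _ i j := GRing.isLinear.Build C P P _ (rotgen i j)
  (rotgen_is_linear i j).

Lemma rotgenD i j u v : rotgen i j (u + v) = rotgen i j u + rotgen i j v.
Proof. exact: linearD. Qed.

Lemma rotgenZ i j (a : C) u : rotgen i j (a *: u) = a *: rotgen i j u.
Proof. exact: linearZ. Qed.

Lemma rotgenM i j u v : rotgen i j (u * v) = rotgen i j u * v + u * rotgen i j v.
Proof. by rewrite /rotgen !mderivM; ring. Qed.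

Lemma rotgenC i j (a : C) : rotgen i j (mpolyC n a) = 0.
Proof. by rewrite /rotgen !mderivC !mulr0 subrr. Qed.

Lemma rotgenX i j k :
  rotgen i j (varX k) = varX i * (j == k)%:R - varX j * (i == k)%:R.
Proof. by rewrite /rotgen !mderiv_varX. Qed.

Lemma rotgen_id i u : rotgen i i u = 0.
Proof. exact: subrr. Qed.

Lemma sum_delta i (F : 'I_n -> P) : \sum_j (i == j)%:R * F j = F i.
Proof.
rewrite (bigD1 i)//= eqxx mul1r big1 ?addr0// => j ji.
by rewrite eq_sym (negbTE ji) mul0r.
Qed.

(** Up to a factor 2 this restricts to the Laplace-Beltrami operator of the
    unit sphere: each pair (i, j) is counted twice. *)
Definition casimir u : P := \sum_i \sum_j rotgen i j (rotgen i j u).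

(** Harmonic polynomials of degree d are therefore eigenvectors and, for n >=
    2, distinct degrees have distinct eigenvalues. *)
Lemma casimirE d u : homog d u -> casimir u =
  2%:R *: (sqnorm * laplacian u - (d%:R * (d%:R + n%:R - 2)) *: u).
Proof.
rewrite /casimir; move=> hu; have E1 := eulerE hu.
have E2 : euler (euler u) = (d%:R * d%:R) *: u.
  by rewrite E1 /euler; under eq_bigr => i _ do rewrite linearZ/= -scalerAr;
     rewrite -scaler_sumr -[X in _ *: X]/(euler u) E1 scalerA.
have E3 : \sum_i \sum_j varX i * varX j * mderiv i (mderiv j u) =
    euler (euler u) - euler u.
  rewrite /euler -sumrB; apply: eq_bigr => i _.
  rewrite linear_sum/= mulr_sumr.
  transitivity (\sum_j (varX i * mderiv i (varX j * mderiv j u) -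
    (i == j)%:R * (varX i * mderiv j u))).
    by apply: eq_bigr => j _; rewrite mderivM mderiv_varX; ring.
  by rewrite sumrB sum_delta.
pose A i j := varX i ^+ 2 * mderiv j (mderiv j u).
pose B i := varX i * mderiv i u.
have sA : \sum_i \sum_j A i j = sqnorm * laplacian u.
  by rewrite /sqnorm mulr_suml; apply: eq_bigr => i _; rewrite mulr_sumr.
have step i j : rotgen i j (rotgen i j u) = A i j + A j i
    - (varX i * varX j * mderiv i (mderiv j u)) *+ 2
    - B i - B j + ((i == j)%:R * (B j)) *+ 2.
  rewrite /rotgen !(mderivM, mderivB)/= !mderiv_varX !eqxx (eq_sym j i) /A /B.
  rewrite (mderiv_comm i j).
  case: (eqVneq i j) => [->|_] /=; first exact: casimir_diag.
  exact: casimir_offdiag.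
transitivity (\sum_i \sum_j (A i j + A j i
    - (varX i * varX j * mderiv i (mderiv j u)) *+ 2
    - B i - B j + ((i == j)%:R * (B j)) *+ 2)).
  by apply: eq_bigr => i _; apply: eq_bigr => j _; exact: step.
rewrite sum_casimir sA E3 E2 -[\sum_i B i]/(euler u) E1.
exact: casimir_scalar.
Qed.

End algebra.

Opaque rotgen euler.

(** * Orthogonal projections for a semi-inner product *)

(** Elements of H at distance 0 need not be equal, and the form is only
    controlled on the set H, as for square-integrable functions before
    identification. *)
Section semi_inner_product.
Context (R : realType) (V : lmodType R[i]).
Local Notation C := R[i].
Variables (H : set V) (ip : V -> V -> C).
Hypothesis H0 : H 0.
Hypothesis HL : forall a x y, H x -> H y -> H (a *: x + y).
Hypothesis ipL : forall a x y z, H x -> H y -> H z ->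
  ip (a *: x + y) z = a * ip x z + ip y z.
Hypothesis ipC : forall x y, H x -> H y -> ip y x = (ip x y)^*%R.
Hypothesis ip_ge0 : forall x, H x -> 0 <= ip x x.

Let HZ a x : H x -> H (a *: x).
Proof. by move=> Hx; rewrite -[_ *: _]addr0; exact: HL. Qed.

Let HD x y : H x -> H y -> H (x + y).
Proof. by move=> Hx Hy; rewrite -[x]scale1r; exact: HL. Qed.

Let HB x y : H x -> H y -> H (x - y).
Proof. by move=> Hx Hy; rewrite addrC -scaleN1r; exact: HL. Qed.

Let Hsum (xs : nat -> V) N : (forall m, H (xs m)) ->
  H (\sum_(0 <= m < N) xs m).
Proof. by move=> Hxs; elim/big_ind: _ => // *; exact: HD. Qed.

Let ip0l z : H z -> ip 0 z = 0.
Proof.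
move=> Hz; have := ipL (-1) H0 H0 Hz.
by rewrite scaler0 addr0 mulN1r addNr.
Qed.

Let ipDl x y z : H x -> H y -> H z -> ip (x + y) z = ip x z + ip y z.
Proof. by move=> Hx Hy Hz; rewrite -[x in LHS]scale1r ipL// mul1r. Qed.

Let ipZl a x z : H x -> H z -> ip (a *: x) z = a * ip x z.
Proof. by move=> Hx Hz; rewrite -[a *: x]addr0 ipL// ip0l// addr0. Qed.

Let ipBl x y z : H x -> H y -> H z -> ip (x - y) z = ip x z - ip y z.
Proof.
by move=> Hx Hy Hz; rewrite addrC -scaleN1r ipL// mulN1r addrC.
Qed.

Let ipDr x y z : H x -> H y -> H z -> ip z (x + y) = ip z x + ip z y.
Proof.
move=> Hx Hy Hz; rewrite (ipC (HD Hx Hy) Hz) ipDl// rmorphD/=.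
by rewrite -(ipC Hx Hz) -(ipC Hy Hz).
Qed.

Let ipZr a x z : H x -> H z -> ip z (a *: x) = a^* * ip z x.
Proof.
by move=> Hx Hz; rewrite (ipC (HZ a Hx) Hz) ipZl// rmorphM/= -(ipC Hx Hz).
Qed.

Let ipBr x y z : H x -> H y -> H z -> ip z (x - y) = ip z x - ip z y.
Proof.
move=> Hx Hy Hz; rewrite (ipC (HB Hx Hy) Hz) ipBl// rmorphB/=.
by rewrite -(ipC Hx Hz) -(ipC Hy Hz).
Qed.

Let ip_suml (xs : nat -> V) N z : (forall m, H (xs m)) -> H z ->
  ip (\sum_(0 <= m < N) xs m) z = \sum_(0 <= m < N) ip (xs m) z.
Proof.
move=> Hxs Hz; elim: N => [|N IH]; first by rewrite !big_nil ip0l.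
by rewrite !big_nat_recr//= ipDl ?IH//; exact: Hsum.
Qed.

Let ip_sumr (xs : nat -> V) N z : (forall m, H (xs m)) -> H z ->
  ip z (\sum_(0 <= m < N) xs m) = \sum_(0 <= m < N) ip z (xs m).
Proof.
move=> Hxs Hz; rewrite (ipC (Hsum _ Hxs) Hz) ip_suml// rmorph_sum.
by apply: eq_bigr => m _ /=; rewrite -(ipC (Hxs m) Hz).
Qed.

(** The degenerate case of the Cauchy-Schwarz inequality: x - t <x, y> y has
    norm <x, x> - 2 t |<x, y>|^2, which is nonnegative for all real t. *)
Lemma ip_null x y : H x -> H y -> ip y y = 0 -> ip x y = 0.
Proof.
move=> Hx Hy y0; set c := ip x y.
have ineq (t : R) : 0 <= ip x x - 2 * t%:C * (c * c^*).
  have Hty : H ((t%:C * c) *: y) := HZ _ Hy.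
  have := ip_ge0 (HB Hx Hty).
  rewrite (ipBl Hx Hty (HB Hx Hty)) (ipBr Hx Hty Hx) (ipBr Hx Hty Hty).
  rewrite (ipZl _ Hy Hx) (ipZl _ Hy Hty) !ipZr// y0 (ipC Hx Hy) -/c.
  rewrite (_ : (t%:C * c)^* = t%:C * c^*)%R; last first.
    rewrite -[LHS]/(conjc _) -[c^*%R]/(conjc _); case: (c) => a b /=.
    by congr (_ +i* _); ring.
  congr (0 <= _); ring.
pose r := complex.Re (ip x x); pose s := complex.Re (c * c^*).
have sE : c * c^* = s%:C.
  rewrite /s -[c^*%R]/(conjc c).
  by case: (c) => a b /=; simpc; congr (_ +i* _); ring.
have xE : ip x x = r%:C by rewrite RRe_real// ger0_real// ip_ge0.
have s0 : s = 0.
  apply/eqP; rewrite -[_ == _]negbK; apply/negP => sn0.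
  have := ineq ((r + 1) / s); rewrite xE sE -mulrA -rmorphM/= divfK//.
  rewrite -[2]/(2%:R) -(rmorph_nat (real_complex R)) -rmorphM -rmorphB lecR.
  by have := ip_ge0 Hx; rewrite xE lecR; lra.
move: s0; rewrite /s -[c^*%R]/(conjc c); case: (c) => a b /=; rewrite mulrN opprK => /eqP.
rewrite -!expr2 paddr_eq0 ?sqr_ge0// !sqrf_eq0 => /andP[/eqP -> /eqP ->] //.
Qed.

Local Notation norm := (hnorm ip).

Definition linear_set (W : set V) :=
  W 0 /\ forall a x y, W x -> W y -> W (a *: x + y).

Definition is_proj (W : set V) x y := W y /\ forall z, W z -> ip (x - y) z = 0.

Lemma is_proj_le W x y w : W `<=` H -> linear_set W -> H x -> is_proj W x y ->
  W w -> norm (x - y) <= norm (x - w).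
Proof.
move=> WH [W0 WL] Hx [Wy xy] Ww; rewrite /hnorm ler_wsqrtr//.
have Wyw : W (y - w) by rewrite addrC -scaleN1r; exact: WL.
have Hxy : H (x - y) by apply: HB => //; exact: WH.
have Hyw := WH _ Wyw.
have Hxyw := HD Hxy Hyw.
rewrite -[x - w](subrKA y) (ipDl Hxy Hyw Hxyw) (ipDr Hxy Hyw Hxy).
rewrite (ipDr Hxy Hyw Hyw) (xy _ Wyw) addr0.
rewrite (ipC Hxy Hyw) (xy _ Wyw) conjC0 add0r raddfD/= lerDl.
by have := ip_ge0 Hyw; rewrite lecE => /andP[].
Qed.

(** By induction on the number of generators: either W lies in the span of all
    of them but one, or W is spanned by its part W' in that span and one more
    vector w0, which can be made orthogonal to W' by induction. This avoids
    bases, which null vectors would complicate. *)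
Lemma proj_exists N (e : 'I_N -> V) (W : set V) : W `<=` H -> linear_set W ->
  (forall w, W w -> exists c : 'I_N -> C, w = \sum_i c i *: e i) ->
  forall x, H x -> exists y, is_proj W x y.
Proof.
elim: N e W => [|N IH] e W WH [W0 WL] spanW x Hx.
  exists 0; split=> // z Wz; have [c ->] := spanW z Wz.
  by rewrite big_ord0 subr0 (ipC H0 Hx) ip0l// conjC0.
pose e' i := e (lift ord0 i).
pose W' := [set w | W w /\ exists c : 'I_N -> C, w = \sum_i c i *: e' i].
have W'W : W' `<=` W by move=> w [].
have W'H := subset_trans W'W WH.
have linW' : linear_set W'.
  split; first by split=> //; exists (fun=> 0); rewrite big1// => i; rewrite scale0r.
  move=> a u v [Wu [c uE]] [Wv [d vE]]; split; first exact: WL.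
  exists (fun i => a * c i + d i); rewrite uE vE scaler_sumr -big_split.
  by apply: eq_bigr => i _; rewrite scalerDl scalerA.
have {}IH := IH e' W' W'H linW' (fun w => @proj2 _ _).
have [y' [W'y' xy']] := IH x Hx.
have [WW'|/existsNP[w0 /not_implyP[Ww0 W'w0]]] := pselect (W `<=` W').
  by exists y'; split; [exact: W'W|move=> z /WW'; exact: xy'].
have [c0 w0E] := spanW w0 Ww0.
have c00 : c0 ord0 != 0.
  apply/eqP => c00; apply: W'w0; split => //; exists (c0 \o lift ord0).
  by rewrite w0E big_ord_recl c00 scale0r add0r.
have [w0' [W'w0' w0w0']] := IH w0 (WH _ Ww0).
pose w1 := w0 - w0'.
have Ww1 : W w1 by rewrite /w1 addrC -scaleN1r; apply: WL => //; exact: W'W.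
have Hw1 := WH _ Ww1.
have decomp w : W w -> exists a v, W' v /\ w = a *: w1 + v.
  move=> Ww; have [c wE] := spanW w Ww; pose a := c ord0 / c0 ord0.
  exists a, (w - a *: w1); split; last by rewrite addrC subrK.
  have -> : w - a *: w1 = a *: w0' + (w - a *: w0).
    by rewrite /w1 scalerBr opprB addrCA.
  apply: linW'.2 => //; split.
    by rewrite addrC -scaleNr; exact: WL.
  exists (fun i => c (lift ord0 i) - a * c0 (lift ord0 i)).
  rewrite wE w0E !big_ord_recl scalerDr scalerA divfK// opprD addrACA subrr add0r.
  rewrite scaler_sumr -sumrB; apply: eq_bigr => i _.
  by rewrite scalerBl scalerA.
(* when w1 is a null vector, b is 0 and nothing has to be added to y' *)
pose b := ip x w1 / ip w1 w1.
have Hy' := W'H _ W'y'.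
have y'w1 : ip y' w1 = 0 by rewrite (ipC Hw1 Hy') (w0w0' _ W'y') conjC0.
have xw1 : ip (x - b *: w1 - y') w1 = 0.
  rewrite (ipBl (HB Hx (HZ b Hw1)) Hy' Hw1) (ipBl Hx (HZ b Hw1) Hw1).
  rewrite y'w1 subr0 ipZl//.
  have [z|nz] := eqVneq (ip w1 w1) 0; last by rewrite /b divfK// subrr.
  by rewrite z mulr0 (ip_null Hx Hw1 z) subr0.
exists (b *: w1 + y'); split; first by apply: WL => //; exact: W'W.
move=> z Wz; have [a [v [W'v ->]]] := decomp z Wz.
have Hv := W'H _ W'v.
have Hxb : H (x - b *: w1 - y') by do 2! apply: HB => //; exact: HZ.
rewrite opprD addrA (ipDr (HZ a Hw1) Hv Hxb) (ipZr _ Hw1 Hxb) xw1 mulr0 add0r.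
rewrite addrAC (ipBl (HB Hx Hy') (HZ b Hw1) Hv) xy'// ipZl// w0w0'//.
by rewrite mulr0 subr0.
Qed.

(** The projection of x is at least as close to x as the approximating
    sequence, so it is at distance 0. *)
Lemma is_proj_closed W x (w : nat -> V) : W `<=` H -> linear_set W -> H x ->
  (exists y, is_proj W x y) -> (forall k, W (w k)) ->
  norm (w k - x) @[k --> \oo] --> 0 -> exists2 y, W y & norm (x - y) = 0.
Proof.
move=> WH linW Hx [y Py] Ww wx; exists y; first by case: Py.
apply/eqP; rewrite eq_le sqrtr_ge0 andbT.
have normC k : norm (w k - x) = norm (x - w k).
  have Hk := HB Hx (WH _ (Ww k)).
  rewrite /hnorm -[w k - x]opprB; move: (x - w k) Hk => v Hk.
  rewrite -scaleN1r; congr (Num.sqrt (complex.Re _)).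
  by rewrite (ipZl _ Hk (HZ _ Hk)) (ipZr _ Hk Hk) rmorphN1 !mulN1r opprK.
rewrite -(cvg_lim _ wx)//; apply: limr_ge; first by apply/cvg_ex; exists 0.
by apply: nearW => k; rewrite normC; exact: (is_proj_le WH linW Hx Py (Ww k)).
Qed.

(** The components of x are its projections on the Hm. By orthogonality their
    partial sums are the projections on the sums of the first Hm, hence optimal
    approximations, and density makes them converge. *)
Lemma direct_sum_criterion (eqH : V -> V -> Prop) (Hm : nat -> set V) :
  (forall x y, H x -> H y -> norm (x - y) = 0 -> eqH x y) ->
  (forall m, Hm m `<=` H) -> (forall m, linear_set (Hm m)) ->
  (forall m x, H x -> exists y, is_proj (Hm m) x y) ->
  (forall m k, m <> k -> orthogonal_sets ip (Hm m) (Hm k)) ->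
  (forall x (eps : R), H x -> 0 < eps -> exists N (w : nat -> V),
    (forall m, Hm m (w m)) /\ norm (x - \sum_(0 <= m < N) w m) < eps) ->
  hilbert_direct_sum H eqH ip Hm.
Proof.
move=> eqHP HmH linHm projHm orthHm dense; split => //.
- move=> m; split => //; first exact: (linHm m).1.
    exact: (linHm m).2.
  move=> w x Ww Hx wx.
  have [y Wy xy] := is_proj_closed (HmH m) (linHm m) Hx (projHm m x Hx) Ww wx.
  by exists y => //; apply: eqHP => //; exact: HmH Wy.
- move=> x Hx; have /choice[xs xsP] := fun m => projHm m x Hx.
  exists xs; first by move=> m; exact: (xsP m).1.
  have Hxs m : H (xs m) := HmH m _ (xsP m).1.
  apply/cvgrPdist_lt => eps eps0; have [N [w [Ww xw]]] := dense x eps Hx eps0.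
  exists N => // M /= NM; rewrite sub0r normrN ger0_norm ?sqrtr_ge0//.
  apply: le_lt_trans xw.
  pose w' m := if (m < N)%N then w m else 0.
  have Ww' m : Hm m (w' m) by rewrite /w'; case: ifP => _ //; exact: (linHm m).1.
  have -> : \sum_(0 <= m < N) w m = \sum_(0 <= m < M) w' m.
    rewrite (big_cat_nat (leq0n _) NM)//= [X in _ + X]big_nat_cond [X in _ + X]big1 ?addr0.
      by apply: eq_big_nat => m /andP[_ mN]; rewrite /w' mN.
    by move=> m /andP[/andP[Nm _] _]; rewrite /w' ltnNge Nm.
  pose WM := [set v | exists v_ : nat -> V, (forall m, Hm m (v_ m)) /\
    v = \sum_(0 <= m < M) v_ m].
  have HWM : WM `<=` H.
    by move=> _ [v_ [Wv ->]]; apply: Hsum => m; exact: HmH (Wv m).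
  apply: (@is_proj_le WM); [exact: HWM| |by []| |by exists w'].
    split; first by exists (fun=> 0); rewrite big1//; split=> // m; exact: (linHm m).1.
    move=> a _ _ [u [Wu ->]] [v [Wv ->]]; exists (fun m => a *: u m + v m).
    by split; [move=> m; exact: (linHm m).2|rewrite scaler_sumr big_split].
  split; first by exists xs; split=> // m; exact: (xsP m).1.
  move=> _ [v [Wv ->]]; have Hv m : H (v m) := HmH m _ (Wv m).
  rewrite ip_sumr//; last by apply: HB => //; exact: Hsum.
  apply: big1_seq => m /andP[_]; rewrite mem_index_iota => /andP[_ mM].
  rewrite (ipBl Hx (Hsum M Hxs) (Hv m)) ip_suml// (bigD1_seq m) ?mem_index_iota ?iota_uniq//=.
  rewrite big1 => [|l lm]; last by apply: (orthHm l m) => //; [exact/eqP|exact: (xsP l).1].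
  by rewrite addr0 -ipBl//; exact: (xsP m).2.
Qed.

End semi_inner_product.

(** * Polynomials approximating a step *)

Section step_poly.
Context (R : realType).

Lemma bernoulli_ineq (x : R) k : -1 <= x -> 1 + k%:R * x <= (1 + x) ^+ k.
Proof.
move=> x1; elim: k => [|k IH]; first by rewrite mul0r addr0.
rewrite exprS; apply: (@le_trans _ _ ((1 + x) * (1 + k%:R * x))).
  by rewrite -natr1; have := ler0n R k; nra.
by rewrite ler_wpM2l//; lra.
Qed.

Lemma exprn_bernoulli (x : R) k : 0 <= x <= 1 ->
  (1 - x) ^+ k <= (1 + k%:R * x)^-1.
Proof.
move=> /andP[x0 x1]; have kx : 0 <= k%:R * x by rewrite mulr_ge0.
rewrite -[leRHS]mul1r ler_pdivlMr ?ltr_pwDl//.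
apply: (@le_trans _ _ ((1 - x) ^+ k * (1 + x) ^+ k)).
  by rewrite ler_wpM2l ?exprn_ge0 ?subr_ge0// bernoulli_ineq//; lra.
by rewrite -exprMn exprn_ile1//; nra.
Qed.

Lemma cvg_inv_linear (c : R) (d : R) : 0 <= c -> 0 < d ->
  c / (1 + k%:R * d) @[k --> \oo] --> (0 : R).
Proof.
move=> c0 d0; apply/cvgrPdist_lt => e e0.
exists (Num.truncn (c / (d * e))).+1 => // k /= Kk.
have kd : 0 <= k%:R * d by rewrite mulr_ge0// ltW.
rewrite sub0r normrN ger0_norm ?divr_ge0 ?addr_ge0//.
rewrite ltr_pdivrMr ?ltr_pwDl//.
have : c / (d * e) < k%:R.
  by rewrite (lt_le_trans (truncnS_gt _))// ler_nat.
by rewrite ltr_pdivrMr ?mulr_gt0//; nra.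
Qed.

(** On [0, 1] these polynomials tend to the indicator of s < 1/2. The factor k
    of the outer exponent makes them tend to 0 at s = 1/2 itself, where (1 -
    s^k)^(2^k) would tend to 1/e. As the inner exponent is even, k (2 s)^(2 k)
    is k times a square, and tends to 0 for s < 1/2 by Bernoulli's inequality
    alone. *)
Definition step_poly (k : nat) (s : R) : R :=
  (1 - s ^+ (2 * k)) ^+ (k * 2 ^ (2 * k)).

Lemma step_poly_bounded k s : 0 <= s <= 1 -> `|step_poly k s| <= 1.
Proof.
move=> /andP[s0 s1]; have sk1 : s ^+ (2 * k) <= 1 by rewrite exprn_ile1.
have sk0 : 0 <= s ^+ (2 * k) by rewrite exprn_ge0.
rewrite ger0_norm ?exprn_ge0 ?subr_ge0//.
by rewrite exprn_ile1 ?subr_ge0// gerBl.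
Qed.

(** Bernoulli's inequality bounds the distance to the limit by k (2 s)^(2k)
    below 1/2 and by 1 / (1 + k (2 s)^(2k)) from 1/2 on. *)
Lemma step_poly_cvg (s : R) : 0 <= s <= 1 ->
  step_poly k s @[k --> \oo] --> ((s < 2^-1)%R%:R : R).
Proof.
move=> /[dup] s01 /andP[s0 s1].
have st k : 0 <= s ^+ (2 * k) <= 1 by rewrite exprn_ge0// exprn_ile1.
have scale k : (k * 2 ^ (2 * k))%:R * s ^+ (2 * k) = k%:R * ((2 * s) ^+ k) ^+ 2.
  by rewrite -exprM [X in _ = _ * _ ^+ X]mulnC natrM natrX -mulrA -exprMn.
suff [c [d [c0 d0 bound]]] : exists c d : R, [/\ 0 <= c, 0 < d &
    forall k, `|(s < 2^-1)%R%:R - step_poly k s| <= c / (1 + k%:R * d)].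
  apply/cvgrPdist_lt => e e0.
  have /cvgrPdist_lt/(_ e e0) := cvg_inv_linear c0 d0.
  apply: filterS => k; rewrite sub0r normrN => h.
  exact: le_lt_trans (bound k) (le_lt_trans (ler_norm _) h).
have [s2|s2] := ltP s 2^-1.
  pose d : R := 1 - 2 * s; have d0 : 0 < d by rewrite /d; lra.
  exists d^-1, d; split => [||k]; [by rewrite invr_ge0 ltW|by []|].
  have /andP[t0 t1] := st k.
  have kd : 0 <= k%:R * d by rewrite mulr_ge0// ltW.
  rewrite ger0_norm; last first.
    by rewrite subr_ge0 exprn_ile1 ?subr_ge0// gerBl.
  apply: (@le_trans _ _ ((k * 2 ^ (2 * k))%:R * s ^+ (2 * k))).
    have := @bernoulli_ineq (- s ^+ (2 * k)) (k * 2 ^ (2 * k)).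
    by rewrite lerN2 mulrN => /(_ t1); rewrite /step_poly /=; lra.
  rewrite scale; have qk : (2 * s) ^+ k <= (1 + k%:R * d)^-1.
    by rewrite (_ : 2 * s = 1 - d) ?exprn_bernoulli//; rewrite /d; lra.
  have q0 : 0 <= (2 * s) ^+ k by rewrite exprn_ge0//; lra.
  set I := (1 + k%:R * d)^-1 in qk *.
  have I0 : 0 <= I by rewrite invr_ge0 addr_ge0.
  have kI : k%:R <= d^-1 * (1 + k%:R * d).
    by rewrite mulrDr mulr1 mulrCA mulVf ?gt_eqF// mulr1 lerDr invr_ge0 ltW.
  apply: (@le_trans _ _ (k%:R * I ^+ 2)).
    by rewrite ler_wpM2l// lerXn2r.
  rewrite expr2 mulrA ler_wpM2r// ler_pdivrMr ?ltr_pwDl//.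
exists 1, 1; split => // k; have /andP[t0 t1] := st k.
rewrite sub0r normrN mul1r mulr1 ger0_norm; last by rewrite exprn_ge0 ?subr_ge0.
apply: (le_trans (exprn_bernoulli _ (st k))).
rewrite lef_pV2 ?posrE ?ltr_pwDl ?mulr_ge0//.
rewrite lerD2l scale ler_peMr//; do 2! apply: exprn_ege1.
by lra.
Qed.

End step_poly.

(** * Dense algebras in the space of square-integrable functions *)

Section L2_algebra.
Context d (T : measurableType d) (R : realType).
Variables (mu : {measure set T -> \bar R}) (D : set T).
Let ltr04 : 0 < 4 :> R.
Proof. exact: ltr0n. Qed.
Hypotheses (mD : measurable D) (muD : (mu D < +oo)%E).
Implicit Types f g h q : T -> R.

Local Notation int f := (Rintegral mu D f).
Definition intg f := mu.-integrable D (EFin \o f).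
Definition sqint f := measurable_fun D f /\ intg (fun x => f x ^+ 2).

Lemma intg_le f g : measurable_fun D f -> intg g ->
  (forall x, D x -> `|f x| <= g x) -> intg f.
Proof.
move=> mf ig fg; apply: (le_integrable mD _ _ ig); first exact/measurable_EFinP.
by move=> x Dx /=; rewrite lee_fin (le_trans (fg x Dx))// ler_norm.
Qed.

Lemma intg_bounded f (M : R) : measurable_fun D f -> (forall x, D x -> `|f x| <= M) ->
  intg f.
Proof.
move=> mf fM; apply: measurable_bounded_integrable => //.
exists M; split; first exact: num_real.
by move=> N MN x Dx /=; rewrite (le_trans (fM x Dx))// ltW.
Qed.

Lemma intgD f g : intg f -> intg g -> intg (fun x => f x + g x).
Proof. exact: integrableD. Qed.

Lemma intgZ a f : intg f -> intg (fun x => a * f x).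
Proof. exact: integrableZl. Qed.

Lemma intgB f g : intg f -> intg g -> intg (fun x => f x - g x).
Proof. exact: integrableB. Qed.

Lemma sqint_bounded f (M : R) : measurable_fun D f ->
  (forall x, D x -> `|f x| <= M) -> sqint f.
Proof.
move=> mf fM; split => //; apply: (@intg_bounded _ (M ^+ 2)).
  exact: measurable_funX.
move=> x Dx; rewrite normrX lerXn2r ?fM// nnegrE.
by rewrite (le_trans _ (fM x Dx)).
Qed.

Lemma sqintM f g : sqint f -> sqint g -> intg (fun x => f x * g x).
Proof.
move=> [mf if2] [mg ig2]; apply: (intg_le _ (intgD if2 ig2)).
  exact: measurable_funM.
move=> x Dx; rewrite ler_norml; apply/andP; split.
  by have := sqr_ge0 (f x + g x); have := sqr_ge0 (f x); have := sqr_ge0 (g x); nra.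
by have := sqr_ge0 (f x - g x); have := sqr_ge0 (f x); have := sqr_ge0 (g x); nra.
Qed.

Lemma sqintD f g : sqint f -> sqint g -> sqint (fun x => f x + g x).
Proof.
move=> sf sg; split; first by apply: measurable_funD; [case: sf|case: sg].
have -> : (fun x => (f x + g x) ^+ 2) =
    (fun x => f x ^+ 2 + (2 * (f x * g x) + g x ^+ 2)).
  by apply/funext => x; ring.
apply: intgD; first by case: sf.
by apply: intgD; [exact/intgZ/sqintM|case: sg].
Qed.

Lemma sqintZ a f : sqint f -> sqint (fun x => a * f x).
Proof.
move=> [mf if2]; split; first exact: measurable_funM.
have -> : (fun x => (a * f x) ^+ 2) = (fun x => a ^+ 2 * f x ^+ 2).
  by apply/funext => x; rewrite exprMn.
exact: intgZ.
Qed.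

Lemma sqintB f g : sqint f -> sqint g -> sqint (fun x => f x - g x).
Proof.
move=> sf sg; have -> : (fun x => f x - g x) = (fun x => f x + -1 * g x).
  by apply/funext => x; rewrite mulN1r.
exact/sqintD/sqintZ.
Qed.

Local Notation dist2 f g := (int (fun x => (f x - g x) ^+ 2)).

Lemma dist2_triangle f g h : sqint f -> sqint g -> sqint h ->
  dist2 f h <= 2 * dist2 f g + 2 * dist2 g h.
Proof.
move=> sf sg sh.
have fg := (sqintB sf sg).2; have gh := (sqintB sg sh).2.
rewrite -!RintegralZl// -RintegralD//; [|exact: intgZ..].
apply: le_Rintegral => //; first exact: (sqintB sf sh).2.
  by apply: intgD; exact: intgZ.
by move=> x Dx; have := sqr_ge0 ((f x - g x) - (g x - h x)); nra.
Qed.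

Variable A : set (T -> R).
Hypotheses (A_cst : forall a, A (cst a))
  (A_add : forall f g, A f -> A g -> A (fun x => f x + g x))
  (A_mul : forall f g, A f -> A g -> A (fun x => f x * g x))
  (A_measT : forall f, A f -> measurable_fun setT f)
  (A_bnd : forall f, A f -> exists M : R, forall x, D x -> `|f x| <= M).

Variable A_gen : measurable `<=`
  <<s [set B | exists q, A q /\ exists a : R, B = [set x | q x < a]] >>.

Let A_meas f : A f -> measurable_fun D f.
Proof. by move=> Af; exact/measurable_funTS/A_measT. Qed.

Definition approximable f :=
  sqint f /\ forall e : R, 0 < e -> exists q, A q /\ dist2 f q < e.

Lemma A_sqint q : A q -> sqint q.
Proof.
by move=> Aq; have [M qM] := A_bnd Aq; exact: (sqint_bounded (A_meas Aq) qM).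
Qed.

Lemma A_approximable q : A q -> approximable q.
Proof.
move=> Aq; split; first exact: A_sqint.
move=> e e0; exists q; split => //.
have -> : (fun x => (q x - q x) ^+ 2) = cst 0.
  by apply/funext => x; rewrite subrr expr0n.
by rewrite Rintegral_cst// mul0r.
Qed.

Lemma approximable_closed f : sqint f ->
  (forall e : R, 0 < e -> exists g, approximable g /\ dist2 f g < e) ->
  approximable f.
Proof.
move=> sf fg; split => // e e0.
have [g [[sg gq] fge]] := fg (e / 4) (divr_gt0 e0 ltr04).
have [q [Aq gqe]] := gq (e / 4) (divr_gt0 e0 ltr04).
exists q; split => //; apply: le_lt_trans (dist2_triangle sf sg (A_sqint Aq)) _.
lra.
Qed.

Lemma approximableD f g : approximable f -> approximable g ->
  approximable (fun x => f x + g x).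
Proof.
move=> [sf fq] [sg gq]; split; first exact: sqintD.
move=> e e0.
have [q [Aq fqe]] := fq (e / 4) (divr_gt0 e0 ltr04).
have [r [Ar gre]] := gq (e / 4) (divr_gt0 e0 ltr04).
exists (fun x => q x + r x); split; first exact: A_add.
have sq := A_sqint Aq; have sr := A_sqint Ar.
apply: (@le_lt_trans _ _ (2 * dist2 f q + 2 * dist2 g r)); last lra.
have ifq := (sqintB sf sq).2; have igr := (sqintB sg sr).2.
rewrite -!RintegralZl// -RintegralD//; [|exact: intgZ..].
apply: le_Rintegral => //.
- exact: (sqintB (sqintD sf sg) (sqintD sq sr)).2.
- by apply: intgD; exact: intgZ.
- by move=> x Dx; have := sqr_ge0 ((f x - q x) - (g x - r x)); nra.
Qed.

Lemma approximableZ a f : approximable f -> approximable (fun x => a * f x).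
Proof.
move=> [sf fq]; split; first exact: sqintZ.
move=> e e0; have c0 : 0 < a ^+ 2 + 1 by rewrite ltr_wpDl ?sqr_ge0.
have [q [Aq fqe]] := fq (e / (a ^+ 2 + 1)) (divr_gt0 e0 c0).
exists (fun x => a * q x); split; first by apply: A_mul => //; exact: (A_cst a).
have ifq := (sqintB sf (A_sqint Aq)).2.
have -> : (fun x => (a * f x - a * q x) ^+ 2) =
    (fun x => a ^+ 2 * (f x - q x) ^+ 2).
  by apply/funext => x; ring.
rewrite RintegralZl//.
have d0 : 0 <= dist2 f q by apply: Rintegral_ge0 => x _; exact: sqr_ge0.
rewrite ltr_pdivlMr// in fqe; apply: le_lt_trans fqe.
by rewrite mulrDr mulr1 mulrC lerDl.
Qed.

Lemma approximable_sum (I : choiceType) (r : seq I) (F : I -> T -> R) :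
  (forall i, approximable (F i)) -> approximable (fun x => \sum_(i <- r) F i x).
Proof.
move=> aF; elim: r => [|i r IH].
  have -> : (fun x => \sum_(i <- [::]) F i x) = cst 0.
    by apply/funext => x; rewrite big_nil.
  exact: A_approximable.
have -> : (fun x => \sum_(j <- i :: r) F j x) =
    (fun x => F i x + \sum_(j <- r) F j x).
  by apply/funext => x; rewrite big_cons.
exact: approximableD.
Qed.

Lemma dist2M f g h (M : R) : sqint f -> sqint g -> measurable_fun D h ->
  (forall x, D x -> `|h x| <= M) ->
  dist2 (fun x => h x * f x) (fun x => h x * g x) <= M ^+ 2 * dist2 f g.
Proof.
move=> sf sg mh hM; have ifg := (sqintB sf sg).2.
have le x : D x -> (h x * f x - h x * g x) ^+ 2 <= M ^+ 2 * (f x - g x) ^+ 2.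
  move=> Dx; rewrite -mulrBr exprMn ler_wpM2r ?sqr_ge0//.
  rewrite -real_normK ?num_real// lerXn2r ?hM// nnegrE.
  by rewrite (le_trans _ (hM x Dx)).
rewrite -RintegralZl//; apply: le_Rintegral => //; last exact: intgZ.
apply: (intg_le _ (intgZ (M ^+ 2) ifg)).
  apply: measurable_funX; apply: measurable_funB; apply: measurable_funM => //.
    by case: sf.
  by case: sg.
by move=> x Dx; rewrite ger0_norm ?sqr_ge0// le.
Qed.

Lemma sqintM_bounded f h (M : R) : sqint f -> measurable_fun D h ->
  (forall x, D x -> `|h x| <= M) -> sqint (fun x => h x * f x).
Proof.
move=> [mf if2] mh hM; split; first exact: measurable_funM.
apply: (intg_le _ (intgZ (M ^+ 2) if2)).
  by apply: measurable_funX; exact: measurable_funM.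
move=> x Dx; rewrite ger0_norm ?sqr_ge0// exprMn ler_wpM2r ?sqr_ge0//.
rewrite -real_normK ?num_real// lerXn2r ?hM// nnegrE.
by rewrite (le_trans _ (hM x Dx)).
Qed.

Let small_quot (M e : R) : 0 < e -> 0 < e / (M ^+ 2 + 1).
Proof. by move=> e0; rewrite divr_gt0// ltr_wpDl ?sqr_ge0. Qed.

Let small_mul (M e x : R) : 0 <= x -> x < e / (M ^+ 2 + 1) -> M ^+ 2 * x < e.
Proof.
move=> x0; rewrite ltr_pdivlMr ?ltr_wpDl ?sqr_ge0//; apply: le_lt_trans.
by rewrite mulrDr mulr1 mulrC lerDl.
Qed.

(** First replace g by q in A, at a cost bounded by the bound on f, then f by a
    member of A, at a cost bounded by the bound on q. *)
Lemma approximableM f g (M : R) : approximable f -> approximable g ->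
  (forall x, D x -> `|f x| <= M) -> approximable (fun x => f x * g x).
Proof.
move=> [sf fq] [sg gq] fM; have mf := sf.1.
apply: approximable_closed; first exact: sqintM_bounded fM.
move=> e e0; have [q [Aq gqe]] := gq _ (small_quot M e0).
have sq := A_sqint Aq; have [N qN] := A_bnd Aq.
exists (fun x => f x * q x); split; last first.
  apply: le_lt_trans (dist2M sg sq mf fM) (small_mul _ gqe).
  by apply: Rintegral_ge0 => x _; exact: sqr_ge0.
have -> : (fun x => f x * q x) = (fun x => q x * f x).
  by apply/funext => x; rewrite mulrC.
split; first exact: (sqintM_bounded sf (A_meas Aq) qN).
move=> e' e'0; have [r [Ar fre]] := fq _ (small_quot N e'0).
exists (fun x => q x * r x); split; first exact: A_mul.
apply: le_lt_trans (dist2M sf (A_sqint Ar) (A_meas Aq) qN) (small_mul _ fre).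
by apply: Rintegral_ge0 => x _; exact: sqr_ge0.
Qed.

Lemma approximable_dominated f (f_ : nat -> T -> R) g : sqint f ->
  (forall k, approximable (f_ k)) -> intg g ->
  (forall k x, D x -> (f x - f_ k x) ^+ 2 <= g x) ->
  (forall x, D x -> f_ k x @[k --> \oo] --> f x) -> approximable f.
Proof.
move=> sf af ig fg ff; apply: approximable_closed => // e e0.
have mk k : measurable_fun D (fun x => (f x - f_ k x) ^+ 2).
  by apply: measurable_funX; apply: measurable_funB; [case: sf|case: (af k) => -[]].
have mEk k : measurable_fun D (fun x => ((f x - f_ k x) ^+ 2)%:E).
  exact/measurable_EFinP.
have ae0 : {ae mu, forall x, D x ->
    ((f x - f_ k x) ^+ 2)%:E @[k --> \oo] --> cst (0%E : \bar R) x}.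
  apply: aeW => x Dx; apply: cvg_EFin; first exact: nearW.
  rewrite [X in _ --> X](_ : _ = (f x - f x) ^+ 2 :> R); last first.
    by rewrite subrr expr0n.
  apply: (@continuous_cvg _ _ _ _ _ _ (fun y : R => y ^+ 2)).
    exact: exprn_continuous.
  by apply: cvgB; [exact: cvg_cst|exact: ff].
have aeg : {ae mu, forall x k, D x ->
    (`|((f x - f_ k x) ^+ 2)%:E| <= (EFin \o g) x)%E}.
  by apply: aeW => x k Dx /=; rewrite lee_fin ger0_norm ?sqr_ge0// fg.
have [_ _] := dominated_convergence mD mEk (measurable_cst _) ae0 ig aeg.
rewrite integral0 => cv.
have /cv : nbhs (0%E : \bar R) [set y | (y < e%:E)%E].
  by apply: open_nbhs_nbhs; split; [exact: open_ereal_lt_ereal|rewrite /= lte_fin].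
move=> [K _ /(_ K (leqnn K))] /= lt_e; exists (f_ K); split; first exact: af.
rewrite -lte_fin /Rintegral fineK//.
by apply: integrable_fin_num => //; exact: (sqintB sf (af K).1).2.
Qed.

Lemma bounded_approximable_limit f (f_ : nat -> T -> R) (M : R) :
  measurable_fun D f -> (forall x, D x -> `|f x| <= M) ->
  (forall k, approximable (f_ k)) -> (forall k x, D x -> `|f_ k x| <= M) ->
  (forall x, D x -> f_ k x @[k --> \oo] --> f x) -> approximable f.
Proof.
move=> mf fM af fkM ff.
apply: (@approximable_dominated f f_ (cst ((M + M) ^+ 2))) => //.
- exact: sqint_bounded fM.
- by apply: (@intg_bounded _ `|(M + M) ^+ 2|).
- move=> k x Dx; rewrite -[_ ^+ 2]real_normK ?num_real// lerXn2r ?nnegrE//.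
    by rewrite (le_trans _ (lerD (fM x Dx) (fM x Dx)))// addr_ge0.
  by rewrite (le_trans (ler_normB _ _))// lerD ?fM ?fkM.
Qed.

Definition approximable_set B := measurable B /\ approximable (\1_B : T -> R).

Lemma approximable_indicU B1 B2 : approximable_set B1 -> approximable_set B2 ->
  approximable_set (B1 `|` B2).
Proof.
move=> [mB1 a1] [mB2 a2]; split; first exact: measurableU.
have -> : \1_(B1 `|` B2) = (fun x => \1_B1 x +
    (\1_B2 x + -1 * (\1_B1 x * \1_B2 x))) :> (T -> R).
  apply/funext => x; rewrite !indicE in_setU.
  by case: (x \in B1); case: (x \in B2) => /=; ring.
apply: approximableD => //; apply: approximableD => //; apply: approximableZ.
apply: (@approximableM _ _ 1) => // x _.
by rewrite indicE; case: (x \in B1); rewrite ?normr1 ?normr0.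
Qed.

(** Products of bounded approximable functions give finite intersections, and
    bounded limits give countable unions. *)
Lemma sigma_algebra_approximable : sigma_algebra setT approximable_set.
Proof.
split.
- split; first exact: measurable0.
  by rewrite indic0; exact: A_approximable (A_cst 0).
- move=> B [mB aB]; rewrite setTD; split; first exact: measurableC.
  have -> : \1_(~` B) = (fun x => cst 1 x + -1 * \1_B x) :> (T -> R).
    apply/funext => x; rewrite !indicE in_setC.
    by case: (x \in B) => /=; ring.
  apply: approximableD; last exact: approximableZ.
  exact: A_approximable (A_cst 1).
- move=> F aF; have mF : measurable (\bigcup_k F k).
    by apply: bigcupT_measurable => k; case: (aF k).
  split => //; pose G k := \big[setU/set0]_(i < k) F i.
  have aG k : approximable_set (G k).
    rewrite /G; elim: k => [|k IH].
      rewrite big_ord0; split; first exact: measurable0.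
      by rewrite indic0; exact: A_approximable (A_cst 0).
    by rewrite big_ord_recr /=; exact: approximable_indicU.
  have indic1 (B : set T) x : `|\1_B x : R| <= 1.
    by rewrite indicE; case: (x \in B); rewrite ?normr1 ?normr0.
  apply: (@bounded_approximable_limit _ (fun k => \1_(G k)) 1) => //.
    by move=> k; exact: (aG k).2.
  move=> x Dx; have [[k _ Fkx]|nFx] := pselect ((\bigcup_k F k) x).
    apply: cvg_near_cst; exists k.+1 => // m /= km.
    rewrite !indicE !mem_set//; first by exists k.
    by rewrite /G -bigcup_mkord; exists k.
  apply: cvg_near_cst; apply: nearW => m; rewrite !indicE !memNset// => Gx.
  by apply: nFx; move: Gx; rewrite /G -bigcup_mkord => -[k _ Fkx]; exists k.
Qed.

Lemma A_exp f k : A f -> A (fun x => f x ^+ k).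
Proof.
move=> Af; elim: k => [|k IH]; first exact: (A_cst 1).
have -> : (fun x => f x ^+ k.+1) = (fun x => f x * f x ^+ k).
  by apply/funext => x; rewrite exprS.
exact: A_mul.
Qed.

Lemma A_step_poly k f : A f -> A (fun x => step_poly k (f x)).
Proof.
move=> Af; apply: (A_exp (f := fun x => 1 - f x ^+ (2 * k))).
have -> : (fun x => 1 - f x ^+ (2 * k)) =
    (fun x => cst 1 x + cst (-1) x * f x ^+ (2 * k)).
  by apply/funext => x; rewrite mulN1r.
apply: A_add; first exact: A_cst.
by apply: A_mul; [exact: A_cst|exact: A_exp].
Qed.

Lemma approximable_sublevel q (a : R) : A q ->
  approximable_set [set x | q x < a].
Proof.
move=> Aq; have mB : measurable [set x | q x < a].
  by rewrite -[X in measurable X]setTI; apply: measurable_fun_ltr => //; exact: A_measT.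
split => //; have [M qM] := A_bnd Aq.
(* s is the affine rescaling of q with s = 1/2 where q = a and values in [0, 1] *)
pose c : R := (2 * (`|M| + `|a| + 1))^-1.
have c0 : 0 < c by rewrite invr_gt0 mulr_gt0// ltr_wpDl// addr_ge0.
pose s x := 2^-1 + c * (q x - a).
have s01 x : D x -> 0 <= s x <= 1.
  move=> Dx; have qa : `|q x - a| <= `|M| + `|a| + 1.
    have := ler_normB (q x) a; have := qM x Dx; have := ler_norm M; lra.
  have : `|c * (q x - a)| <= 2^-1.
    rewrite normrM gtr0_norm// /c invfM -mulrA ler_piMr//.
    by rewrite mulrC ler_pdivrMr ?mul1r// ltr_wpDl// addr_ge0.
  by rewrite ler_norml /s => /andP[]; lra.
have As : A s.
  have -> : s = (fun x => cst 2^-1 x + cst c x * (q x + cst (- a) x)) by [].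
  by do ?[exact: A_cst|apply: A_add|apply: A_mul].
apply: (@bounded_approximable_limit _ (fun k x => step_poly k (s x)) 1) => //.
- by move=> x _; rewrite indicE; case: (x \in _); rewrite ?normr1 ?normr0.
- by move=> k; exact/A_approximable/A_step_poly.
- by move=> k x Dx; exact/step_poly_bounded/s01.
- move=> x Dx; rewrite indicE.
  suff -> : (x \in [set x | q x < a]) = (s x < 2^-1).
    exact: step_poly_cvg (s01 x Dx).
  rewrite /s gtrDl pmulr_rlt0// subr_lt0.
  by apply/idP/idP => [/set_mem//|]; exact: mem_set.
Qed.

Lemma approximable_measurable B : measurable B -> approximable (\1_B : T -> R).
Proof.
move=> /A_gen h; suff [] : approximable_set B by [].
apply: smallest_sub B h; first exact: sigma_algebra_approximable.
by move=> _ [q [Aq [a ->]]]; exact: approximable_sublevel.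
Qed.

Import HBNNSimple.

Lemma approximable_nnsfun (g : {nnsfun T >-> R}) : approximable g.
Proof.
have -> : (g : T -> R) = (fun x => \sum_(y <- finmap.enum_fset (fset_set (range g)))
    y * \1_(g @^-1` [set y]) x).
  by apply/funext => x; rewrite fimfunE fsbig_finite.
apply: approximable_sum => y; apply: approximableZ.
exact: approximable_measurable.
Qed.

Lemma approximable_nonneg f : sqint f -> (forall x, D x -> 0 <= f x) ->
  approximable f.
Proof.
move=> sf f0; have [mf if2] := sf.
have [g [ndg gf]] := approximation mD (iffRL (measurable_EFinP _ _) mf) f0.
have {}gf x : D x -> g k x @[k --> \oo] --> f x.
  by move=> Dx; have /fine_cvgP[_] := gf x Dx; exact.
have g_le k x : D x -> g k x <= f x.
  move=> Dx; rewrite -(cvg_lim _ (gf x Dx))//.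
  apply: (@nondecreasing_cvgn_le _ (fun k => g k x)); last first.
    by apply/cvg_ex; exists (f x); exact: gf.
  by move=> i j ij; have /lefP := ndg i j ij; exact.
apply: (@approximable_dominated f (fun k => g k) (fun x => f x ^+ 2)) => //.
  by move=> k; exact: approximable_nnsfun.
move=> k x Dx; rewrite lerXn2r ?nnegrE ?subr_ge0 ?g_le ?f0//.
by rewrite gerBl fun_ge0.
Qed.

(** All indicators are approximable, hence so are simple functions and their
    dominated limits. *)
Theorem algebra_dense_L2 f : sqint f -> approximable f.
Proof.
move=> sf; have [mf if2] := sf.
have sp (h : T -> R) : sqint h -> sqint (fun x => Num.max (h x) 0).
  move=> [mh ih2]; split; first exact: measurable_maxr.
  apply: (intg_le _ ih2); first by apply/measurable_funX/measurable_maxr.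
  move=> x Dx; rewrite ger0_norm ?sqr_ge0//.
  by case: (leP (h x) 0) => _; rewrite ?expr0n ?sqr_ge0.
have max0 (h : T -> R) x : D x -> 0 <= Num.max (h x) 0.
  by rewrite le_max lexx orbT.
have -> : f = (fun x => Num.max (f x) 0 + -1 * Num.max (-1 * f x) 0).
  apply/funext => x; rewrite !mulN1r; case: (leP (f x) 0) => fx.
    by rewrite max_l ?oppr_ge0// opprK add0r.
  by rewrite max_r ?oppr_le0 ?ltW// oppr0 addr0.
apply: approximableD; first exact: (approximable_nonneg (sp _ sf) (max0 f)).
apply: approximableZ; apply: approximable_nonneg (max0 (fun x => -1 * f x)).
exact/sp/sqintZ.
Qed.

End L2_algebra.

(** * Invariance of the surface measure under isometries *)

Section surface_measure.
Context (R : realType) (n : nat).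
Local Notation S := (sphere R n).
Local Notation mu := (surface_measure R n).
Local Notation V := (borel_rV R n).
Implicit Types (x y : 'rV[R]_n).

Lemma surface_measureE (B : set V) : mu B =
  ((fine (hausdorff n.-1 S))^-1%:E * hausdorff n.-1 (B `&` S))%E.
Proof. by []. Qed.

(** If the Hausdorff measure of the sphere is infinite, the normalising factor
    is 0. *)
Lemma surface_measure_lty (B : set V) : (mu B < +oo)%E.
Proof.
rewrite surface_measureE; have HS0 := @hausdorff_ge0 R n n.-1 S.
have HBS : (hausdorff n.-1 (B `&` S) <= hausdorff n.-1 S)%E.
  by apply: le_hausdorff; exact: subIsetr.
case: (hausdorff n.-1 S) HS0 HBS => [r _ HBS| |//] /=; last first.
  by move=> _ _; rewrite invr0 mul0e.
have := @hausdorff_ge0 R n n.-1 (B `&` S).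
by case: (hausdorff _ _) HBS => [s _ _| |]//; rewrite -EFinM ltry.
Qed.

Lemma enorm_le x : enorm x <= Num.sqrt n%:R * `|x|.
Proof.
rewrite -[`|x|]ger0_norm// -sqrtr_sqr -sqrtrM// ler_wsqrtr//.
rewrite -[n in n%:R]card_ord -sum1_card natr_sum mulr_suml ler_sum// => i _.
rewrite mul1r -real_normK ?num_real// lerXn2r ?nnegrE//.
by rewrite [leRHS]mx_normrE (le_trans _ (le_bigmax _ _ (ord0, i))).
Qed.

Section isometry.
Variables phi psi : 'rV[R]_n -> 'rV[R]_n.
Hypothesis psiK : cancel psi phi.
Hypothesis phi_dist : forall x y, enorm (phi x - phi y) = enorm (x - y).
Hypothesis phi_norm : forall x, enorm (phi x) = enorm x.

Lemma open_preimage_isometry (O : set 'rV[R]_n) : open O -> open (phi @^-1` O).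
Proof.
move=> oO; rewrite openE => x /= Ox.
have /nbhs_ballP[e /= e0 eO] := open_nbhs_nbhs (conj oO Ox).
have c0 : 0 < Num.sqrt n%:R + 1 :> R by rewrite ltr_wpDl ?sqrtr_ge0.
apply/nbhs_ballP; exists (e / (Num.sqrt n%:R + 1)); first exact: divr_gt0.
move=> y; rewrite -ball_normE /= ltr_pdivlMr// => xy; apply: eO.
rewrite -ball_normE /=; apply: le_lt_trans (ler_norm_enorm _) _.
rewrite phi_dist; apply: le_lt_trans (enorm_le _) _; apply: le_lt_trans xy.
by rewrite mulrC ler_wpM2l// lerDl.
Qed.

Lemma measurable_isometry : measurable_fun setT (phi : V -> V).
Proof.
apply: (@measurability _ _ V V setT phi (@open 'rV[R]_n)) => //.
move=> _ [U oU <-]; rewrite setTI.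
by apply: sub_sigma_algebra; exact: open_preimage_isometry.
Qed.

(** Inverse images of a cover form a cover by sets of no larger diameter. *)
Lemma hausdorff_isometry_le s (f : 'rV[R]_n -> 'rV[R]_n) :
  (forall x y, enorm (f x - f y) = enorm (x - y)) ->
  forall B : set 'rV[R]_n, (hausdorff s (f @^-1` B) <= hausdorff s B)%E.
Proof.
move=> fd B; apply: ge_ereal_sup => _ [e e0 <-].
apply: le_trans (hausdorff_pre_le _ _ e0); apply: le_ereal_inf_tmp.
move=> _ [U [BU dU] <-].
apply: (@le_trans _ _ (\sum_(k <oo) diamX s (f @^-1` (U k)))%E).
  apply: ereal_inf_lbound; exists (fun k => f @^-1` (U k)) => //; split.
    by move=> x /BU[k _ Ukx]; exists k.
  by move=> k x y Ux Uy; rewrite -fd; exact: (dU k).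
apply: lee_nneseries => [k *|k _]; first exact: (diamX_ge0 s).
 apply: le_ereal_sup => _ [->|[[x y] [Ux Uy] <-]]; [by left|right].
by exists (f x, f y) => //=; rewrite fd.
Qed.

Lemma surface_measure_isometry (B : set V) : mu (phi @^-1` B) = mu B.
Proof.
rewrite !surface_measureE; congr (_ * _)%E.
have -> : phi @^-1` B `&` S = phi @^-1` (B `&` S).
  by apply/seteqP; split => x /= [Bx]; rewrite /sphere /= phi_norm.
apply/eqP; rewrite eq_le hausdorff_isometry_le//=.
have psi_dist x y : enorm (psi x - psi y) = enorm (x - y).
  by rewrite -phi_dist !psiK.
have := hausdorff_isometry_le n.-1 psi_dist (phi @^-1` (B `&` S)).
by rewrite -comp_preimage (_ : phi \o psi = id)//; apply/funext => x /=.
Qed.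

Lemma Rintegral_isometry (f : 'rV[R]_n -> R) :
  measurable_fun setT (f : V -> R) -> intg mu S (f \o phi : V -> R) ->
  Rintegral mu S (f \o phi : V -> R) = Rintegral mu S (f : V -> R).
Proof.
move=> mf if_; have mS := @measurable_sphere R n.
have phiS : phi @^-1` S = S.
  by apply/seteqP; split => x; rewrite /sphere /= phi_norm.
rewrite /Rintegral; congr fine.
have := @integral_pushforward _ _ V V R phi measurable_isometry mu S (EFin \o f).
rewrite phiS => <-; [|exact/measurable_EFinP|exact: if_|exact: mS].
apply: eq_measure_integral => [|mphi B mB _]; first exact: measurable_isometry.
exact: (surface_measure_isometry B).
Qed.

End isometry.

(** * Generators of the Borel sets *)

Lemma measurable_sphereV : measurable (S : set V).
Proof. exact: measurable_sphere. Qed.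

Lemma measurable_coord i : measurable_fun setT (fun x : V => x ord0 i).
Proof.
apply: (measurability _ (RGenOpens.measurableE R)) => B [_ [a [b ->]] <-].
rewrite setTI; apply: sub_sigma_algebra.
apply: (@open_comp _ _ (fun x : 'rV[R]_n => x ord0 i)); last exact: itv_open.
by move=> x _; exact: coord_continuous.
Qed.

Definition halfspaces : set (set 'rV[R]_n) :=
  [set B | exists i (a : R), B = [set x : 'rV[R]_n | x ord0 i < a]].

(** Each point of an open set lies in a box contained in it, with rational
    centre and size 1 / (k + 1); there are countably many such boxes. *)
Lemma open_halfspaces (O : set 'rV[R]_n) : open O -> <<s halfspaces >> O.
Proof.
move=> oO.
pose W := g_sigma_algebraType halfspaces.
have mlt i a : measurable ([set x : 'rV[R]_n | x ord0 i < a] : set W).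
  by apply: sub_sigma_algebra; exists i, a.
pose box (q : 'rV[rat]_n) (k : nat) := \bigcap_(i in [set: 'I_n])
  [set x : 'rV[R]_n | ratr (q ord0 i) - k.+1%:R^-1 < x ord0 i <
                      ratr (q ord0 i) + k.+1%:R^-1].
have mbox q k : measurable (box q k : set W).
  apply: fin_bigcap_measurable; first exact: finite_finset.
  move=> i _.
  set a := ratr _ - _; set b := ratr _ + _.
  have -> : [set x : 'rV[R]_n | a < x ord0 i < b] =
      ~` (\bigcap_(j in [set: nat]) [set x : 'rV[R]_n | x ord0 i < a + j.+1%:R^-1])
      `&` [set x : 'rV[R]_n | x ord0 i < b].
    apply/seteqP; split => x /=.
      move=> /andP[ax xb]; split => // h; have [j ja] := ltr_add_invr ax.
      by have := h j I; rewrite /= ltNge ltW.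
    move=> [h xb]; rewrite xb andbT ltNge; apply/negP => xa; apply: h => j _ /=.
    by rewrite (le_lt_trans xa)// ltrDl.
  apply: measurableI => //; apply: measurableC.
  exact: bigcapT_measurable.
pose good (qk : 'rV[rat]_n * nat) := `[< box qk.1 qk.2 `<=` O >].
have -> : O = \bigcup_(m in [set: nat])
    (if unpickle m is Some qk then if good qk then box qk.1 qk.2 else set0
     else set0).
  apply/seteqP; split => x; last first.
    move=> [m _]; case: (unpickle m) => // -[q k].
    by rewrite /good; case: asboolP => //= h /h.
  move=> Ox; have /nbhs_ballP[e /= e0 eO] := open_nbhs_nbhs (conj oO Ox).
  have [k ke] := @ltr_add_invr _ 0 (e / 2) (divr_gt0 e0 (ltr0n _ 2)).
  rewrite add0r in ke; have k0 : 0 < k.+1%:R^-1 :> R by rewrite invr_gt0.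
  have /choice[q qP] i : exists q : rat,
      x ord0 i - k.+1%:R^-1 < ratr q < x ord0 i + k.+1%:R^-1.
    have [|q] := @rat_in_itvoo _ (x ord0 i - k.+1%:R^-1) (x ord0 i + k.+1%:R^-1).
      by rewrite ltrBlDr -addrA ltrDl addr_gt0.
    by rewrite in_itv /= => h; exists q.
  pose qr : 'rV[rat]_n := \row_i q i.
  exists (pickle (qr, k)) => //; rewrite pickleK /good asboolT.
    move=> i _ /=; rewrite mxE; have := qP i.
    by rewrite ltrBlDr ltrBlDr -ltrBlDr => /andP[-> ->].
  move=> y By; apply: eO; rewrite -ball_normE /= [ltLHS]mx_normrE.
  apply/bigmax_ltP; split => // -[i j] _ /=; rewrite !mxE (_ : i = ord0); last exact: ord1.
  have := By j I; rewrite /= mxE; have := qP j.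
  move: (k.+1%:R^-1) ke k0 (ratr (q j) : R) (x ord0 j) (y ord0 j) => t te t0 a b c.
  by move=> /andP[a1 a2] /andP[a3 a4]; rewrite ltr_norml; apply/andP; split; lra.
apply: (@bigcup_measurable _ W) => m _; case: (unpickle m) => [qk|//].
by case: (good qk).
Qed.

Lemma borel_halfspaces (B : set V) : measurable B -> <<s halfspaces >> B.
Proof.
apply: smallest_sub; first exact: smallest_sigma_algebra.
exact: open_halfspaces.
Qed.

End surface_measure.

(** * Values of polynomials on the sphere *)

Lemma mpoly_ring_ind (K : comNzRingType) n (P : mpoly n K -> Prop) :
  (forall c, P (mpolyC n c)) -> (forall i, P (mpolyX K (mnm1 i))) ->
  (forall u v, P u -> P v -> P (u + v)) ->
  (forall u v, P u -> P v -> P (u * v)) -> forall u, P u.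
Proof.
move=> PC PX PD PM u; rewrite (mpolyE u).
elim/big_ind: _ => [|v w|m _]; [by rewrite -(mpolyC0 n K)|exact: PD|].
rewrite -mul_mpolyC; apply: (PM) => //; rewrite mpolyXE_id.
elim/big_ind: _ => [|v w|i _]; [by rewrite -(mpolyC1 n K)|exact: PM|].
by elim: (m i) => [|k IH]; [rewrite expr0 -(mpolyC1 n K)|rewrite exprS; exact: PM].
Qed.

(** The error of the first-order expansion of u under a rotation, as it behaves
    under sums and products: a is u, a' its value at the rotated point and da
    its derivative, likewise for b. *)
Lemma defectD (K : comPzRingType) (a b a' b' s da db : K) :
  a' + b' - (a + b) - s * (da + db) = (a' - a - s * da) + (b' - b - s * db).
Proof. ring. Qed.

Lemma defectM (K : comPzRingType) (a b a' b' s da db : K) :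
  a' * b' - a * b - s * (da * b + a * db) =
  s ^+ 2 * (da * db) + (a' - a - s * da) * b' + (a + s * da) * (b' - b - s * db).
Proof. ring. Qed.

Lemma defect_bound (K : numDomainType) (q a b r v w s t Q A B E D W N : K) :
  `|q| <= Q -> `|a| <= A -> `|b| <= B -> `|r| <= E -> `|v| <= D ->
  `|w| <= W -> `|s| <= 1 -> `|t| <= N ->
  `|q * (a * b) + r * v + (w + s * a) * t| <= Q * (A * B) + E * D + (W + A) * N.
Proof.
move=> qQ aA bB rE vD wW s1 tN.
apply: le_trans (ler_normD _ _) (lerD _ _).
  apply: le_trans (ler_normD _ _) (lerD _ _); rewrite !normrM.
    by rewrite ler_pM ?mulr_ge0// ler_pM.
  by rewrite ler_pM.
rewrite normrM ler_pM// (le_trans (ler_normD _ _))// lerD//.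
by rewrite normrM -[leRHS]mul1r ler_pM.
Qed.

Lemma first_order_eq0 (R : realFieldType) (M m a : R) : 0 <= M -> 0 <= m ->
  (forall s, 0 < s -> s <= 1 -> `|s * a| <= M * s ^+ 2 * m) -> a = 0.
Proof.
move=> M0 m0 bound; apply/eqP; rewrite -normr_eq0; apply/eqP/le_anti.
rewrite normr_ge0 andbT leNgt; apply/negP => a0.
have Mm0 := mulr_ge0 M0 m0; have d0 : 0 < 2 * (M * m + `|a|) by lra.
pose s := `|a| / (2 * (M * m + `|a|)).
have s0 : 0 < s by rewrite divr_gt0.
have s1 : s <= 1 by rewrite ler_pdivrMr//; lra.
have := bound s s0 s1; rewrite normrM gtr0_norm//.
rewrite (_ : M * s ^+ 2 * m = s * (M * m * s)) ?ler_pM2l//; last by ring.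
rewrite /s mulrA ler_pdivlMr//; move: (`|a|) a0 d0 => b b0 d0; nra.
Qed.

Lemma eigen_mull (K : comNzRingType) (W : algType K) (a : K) (u v : W) :
  2%:R *: - (a *: u) * v = - (2%:R * a) *: (u * v).
Proof. by rewrite -scaleNr scalerA -scalerAl mulrN. Qed.

Lemma eigen_mulr (K : comNzRingType) (W : algType K) (a : K) (u v : W) :
  u * (2%:R *: - (a *: v)) = - (2%:R * a) *: (u * v).
Proof. by rewrite -scaleNr scalerA -scalerAr mulrN. Qed.

Lemma eigen_separation (K : numDomainType) (a b : nat) (x : K) : a != b ->
  - (2%:R * a%:R) * x = - (2%:R * b%:R) * x -> x = 0.
Proof.
move=> ab /eqP; rewrite -subr_eq0 -mulrBl mulf_eq0 => /orP[|/eqP//].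
rewrite -opprD oppr_eq0 -mulrBr mulf_eq0 pnatr_eq0 /= subr_eq0 eqr_nat.
by rewrite (negbTE ab).
Qed.

Section sphere_polynomials.
Context (R : realType) (n : nat).
Local Notation C := R[i].
Local Notation S := (sphere R n).
Local Notation mu := (surface_measure R n).
Local Notation V := (borel_rV R n).
Local Notation J := (@sphere_integral R n).
Implicit Types (x y : 'rV[R]_n) (u v w : mpoly n C) (h g : 'rV[R]_n -> C).

Definition reval u x : C := meval (fun i => (x ord0 i)%:C) u.

Lemma revalC c x : reval (mpolyC n c) x = c. Proof. exact: mevalC. Qed.
Lemma revalX i x : reval (varX R i) x = (x ord0 i)%:C. Proof. exact: mevalXU. Qed.
Lemma revalD u v x : reval (u + v) x = reval u x + reval v x. Proof. exact: mevalD. Qed.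
Lemma revalB u v x : reval (u - v) x = reval u x - reval v x. Proof. exact: mevalB. Qed.
Lemma revalM u v x : reval (u * v) x = reval u x * reval v x. Proof. exact: mevalM. Qed.
Lemma revalZ c u x : reval (c *: u) x = c * reval u x. Proof. exact: mevalZ. Qed.

Lemma meval_homog (c : C) (z : 'I_n -> C) d u : u \is ishomog1 d mdeg ->
  meval (fun i => c * z i) u = c ^+ d * meval z u.
Proof.
move=> hu; rewrite !mevalE mulr_sumr; apply: eq_big_seq => m mu.
rewrite mulrCA; congr (_ * _); under eq_bigr do rewrite exprMn.
rewrite big_split/=; congr (_ * _).
by rewrite prodrXr -mdegE (dhomog_mf hu mu).
Qed.

Lemma sphere_sum x : S x -> \sum_i x ord0 i ^+ 2 = 1.
Proof.
rewrite /sphere /= /enorm => h.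
rewrite -[LHS]sqr_sqrtr ?h ?expr1n//.
by apply: sumr_ge0 => i _; exact: sqr_ge0.
Qed.

Lemma reval_sqnorm x : S x -> reval (sqnorm R n) x = 1.
Proof.
move=> Sx; rewrite /reval /sqnorm rmorph_sum /=.
under eq_bigr => i _ do rewrite rmorphXn /= mevalXU -rmorphXn.
by rewrite -rmorph_sum /= (sphere_sum Sx).
Qed.

Lemma reval_sqnormX k x : S x -> reval (sqnorm R n ^+ k) x = 1.
Proof.
move=> Sx; elim: k => [|k IH]; first by rewrite expr0 /reval meval1.
by rewrite exprS revalM IH reval_sqnorm// mulr1.
Qed.

Lemma reval_homogN d u x : (u \is ishomog1 d mdeg) ->
  reval u (- x) = (-1) ^+ d * reval u x.
Proof.
move=> hu; rewrite /reval -(meval_homog _ _ hu); apply: meval_eq => i.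
by rewrite mxE mulN1r rmorphN.
Qed.

Lemma reval_nat k x : reval k%:R x = k%:R.
Proof. exact: rmorph_nat. Qed.

Opaque reval sqnorm varX.

Lemma measurable_reval u : measurable_fun setT (fun x : V => complex.Re (reval u x)) /\
  measurable_fun setT (fun x : V => complex.Im (reval u x)).
Proof.
elim/mpoly_ring_ind: u => [c|i|u v [u1 u2] [v1 v2]|u v [u1 u2] [v1 v2]].
- by split; under eq_fun do rewrite revalC; exact: measurable_cst.
- by split; under eq_fun do rewrite revalX /=;
    [exact: measurable_coord|exact: measurable_cst].
- by split; under eq_fun do rewrite revalD raddfD/=; exact: measurable_funD.
- have ReM (a b : C) : complex.Re (a * b) =
      complex.Re a * complex.Re b - complex.Im a * complex.Im b.
    by case: a b => [a1 a2] [b1 b2].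
  have ImM (a b : C) : complex.Im (a * b) =
      complex.Re a * complex.Im b + complex.Im a * complex.Re b.
    by case: a b => [a1 a2] [b1 b2].
  split; under eq_fun do rewrite revalM ?ReM ?ImM.
    by apply: measurable_funB; exact: measurable_funM.
  by apply: measurable_funD; exact: measurable_funM.
Qed.

Lemma sphere_coord x i : S x -> `|x ord0 i| <= 1.
Proof.
rewrite /sphere /= => x1; rewrite -x1; apply: le_trans (ler_norm_enorm x).
by rewrite [leRHS]mx_normrE (le_trans _ (le_bigmax _ _ (ord0, i))).
Qed.

Lemma normc_real (r : R) : `|r%:C| = `|r|%:C :> C.
Proof. by rewrite normc_def /= expr0n addr0 sqrtr_sqr. Qed.

Lemma reval_bounded u : exists2 M : R, 0 <= M & forall x, S x -> `|reval u x| <= M%:C.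
Proof.
elim/mpoly_ring_ind: u => [c|i|u v [M M0 uM] [N N0 vN]|u v [M M0 uM] [N N0 vN]].
- exists (complex.Re `|c|); first by have := normr_ge0 c; rewrite lecE => /andP[].
  by move=> x _; rewrite revalC RRe_real// normr_real.
- exists 1 => // x Sx; rewrite revalX normc_real lecR; exact: sphere_coord.
- exists (M + N); first exact: addr_ge0.
  move=> x Sx; rewrite revalD rmorphD/= (le_trans (ler_normD _ _))//.
  by rewrite lerD ?uM ?vN.
- exists (M * N); first exact: mulr_ge0.
  by move=> x Sx; rewrite revalM rmorphM/= normrM ler_pM ?uM ?vN.
Qed.

Lemma normc_Re (z : C) (M : R) : `|z| <= M%:C -> `|complex.Re z| <= M.
Proof. by move=> zM; rewrite -lecR (le_trans (normc_ge_Re z)). Qed.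

Lemma normc_Im (z : C) (M : R) : `|z| <= M%:C -> `|complex.Im z| <= M.
Proof.
move=> zM; rewrite -normrN -ReiNIm; apply: normc_Re; rewrite normrM.
by rewrite (_ : `|'i%C| = 1) ?mulr1// normc_def /= expr0n expr1n add0r sqrtr1.
Qed.

(** * Integration over the sphere *)

Definition cintg h := intg mu S (fun x : V => complex.Re (h x)) /\
  intg mu S (fun x : V => complex.Im (h x)).

Let mS : measurable (S : set V) := @measurable_sphereV R n.
Let muS : (mu S < +oo)%E := surface_measure_lty S.

Lemma cintg_reval u : cintg (reval u).
Proof.
have [m1 m2] := measurable_reval u; have [M M0 uM] := reval_bounded u.
split; apply: (@intg_bounded _ _ _ mu S mS muS _ M).
- exact: measurable_funTS.
- by move=> x Sx; apply: normc_Re; exact: uM.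
- exact: measurable_funTS.
- by move=> x Sx; apply: normc_Im; exact: uM.
Qed.

Lemma eq_sphere_integral h g : (forall x, S x -> h x = g x) -> J h = J g.
Proof.
move=> hg; rewrite /sphere_integral.
by congr (_ +i* _); apply: eq_Rintegral => x /set_mem Sx; rewrite hg.
Qed.

Lemma intg_comb (a b : R) (f g k : V -> R) : intg mu S f -> intg mu S g ->
  intg mu S k -> intg mu S (fun x => a * f x + b * g x + k x).
Proof.
move=> fi gi ki; apply: (intgD mS) => //.
by apply: (intgD mS); exact: intgZ.
Qed.

Lemma Rintegral_comb (a b : R) (f g k : V -> R) : intg mu S f -> intg mu S g ->
  intg mu S k -> Rintegral mu S (fun x => a * f x + b * g x + k x) =
  a * Rintegral mu S f + b * Rintegral mu S g + Rintegral mu S k.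
Proof.
move=> fi gi ki; rewrite RintegralD//; last first.
  by apply: (intgD mS); exact: intgZ.
by rewrite RintegralD ?RintegralZl//; exact: intgZ.
Qed.

Lemma cplx_combE (a b : R) h g :
  (fun x => complex.Re ((a +i* b) * h x + g x)) =
    (fun x => a * complex.Re (h x) + - b * complex.Im (h x) + complex.Re (g x)) /\
  (fun x => complex.Im ((a +i* b) * h x + g x)) =
    (fun x => a * complex.Im (h x) + b * complex.Re (h x) + complex.Im (g x)).
Proof.
by split; apply/funext => x; case: (h x) (g x) => [c d] [e f] /=; ring.
Qed.

Lemma cintgL a h g : cintg h -> cintg g -> cintg (fun x => a * h x + g x).
Proof.
case: a => a b [h1 h2] [g1 g2]; have [E1 E2] := cplx_combE a b h g.
by split; rewrite ?E1 ?E2; exact: intg_comb.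
Qed.

Lemma sphere_integralL a h g : cintg h -> cintg g ->
  J (fun x => a * h x + g x) = a * J h + J g.
Proof.
case: a => a b [h1 h2] [g1 g2]; have [E1 E2] := cplx_combE a b h g.
rewrite /sphere_integral E1 E2 !Rintegral_comb//; simpc.
by congr (_ +i* _); ring.
Qed.

Lemma sphere_integral_conj h : cintg h ->
  J (fun x => (h x)^*%R) = (J h)^*%R.
Proof.
move=> [h1 h2]; rewrite /sphere_integral -[RHS]/(conjc _) /=.
congr (_ +i* _); first by apply: eq_Rintegral => x _; case: (h x).
rewrite -mulN1r -RintegralZl//; apply: eq_Rintegral => x _.
by rewrite mulN1r; case: (h x).
Qed.

Lemma sphere_integral_ge0 h : (forall x, S x -> 0 <= h x) -> 0 <= J h.
Proof.
move=> h0; rewrite lecE /=; apply/andP; split; last first.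
  by apply: Rintegral_ge0 => x /h0; rewrite lecE => /andP[].
apply/eqP; transitivity (Rintegral mu S (cst 0 : V -> R)); last first.
  by rewrite Rintegral_cst ?mul0r.
by apply: eq_Rintegral => x /set_mem /h0; rewrite lecE /= => /andP[/eqP].
Qed.

Definition sphere_mean u : C := J (reval u).

Lemma sphere_mean_is_linear : scalar sphere_mean.
Proof.
move=> a u v; rewrite /sphere_mean -sphere_integralL; try exact: cintg_reval.
by apply: eq_sphere_integral => x _; rewrite revalD revalZ.
Qed.
HB.instance Definition _ := GRing.isLinear.Build C (mpoly n C) C _ sphere_mean sphere_mean_is_linear.

Lemma sphere_mean_sqnormX k u : sphere_mean (sqnorm R n ^+ k * u) = sphere_mean u.
Proof.
by apply: eq_sphere_integral => x Sx; rewrite revalM reval_sqnormX// mul1r.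
Qed.

Lemma sphere_meanZ a u : sphere_mean (a *: u) = a * sphere_mean u. Proof. exact: linearZ. Qed.
Lemma sphere_meanD u v : sphere_mean (u + v) = sphere_mean u + sphere_mean v. Proof. exact: linearD. Qed.
Lemma sphere_mean_sum (I : finType) (F : I -> mpoly n C) :
  sphere_mean (\sum_k F k) = \sum_k sphere_mean (F k).
Proof. exact: linear_sum. Qed.

Lemma Re_sphere_mean u : complex.Re (sphere_mean u) =
  Rintegral mu S (fun x : V => complex.Re (reval u x)).
Proof. by []. Qed.

Lemma Im_sphere_mean u : complex.Im (sphere_mean u) =
  Rintegral mu S (fun x : V => complex.Im (reval u x)).
Proof. by []. Qed.
Opaque sphere_mean.

(** For k the function f after a rotation by a small angle of sine s, and g the
    derivative of f. *)
Lemma Rintegral_first_order (f g k : V -> R) (s B : R) :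
  intg mu S f -> intg mu S g -> intg mu S k ->
  Rintegral mu S k = Rintegral mu S f ->
  (forall x, S x -> `|k x - f x - s * g x| <= B) ->
  `|s * Rintegral mu S g| <= B * fine (mu S).
Proof.
move=> fi gi ki kf kB; pose r x := -1 * f x + - s * g x + k x.
have ri : intg mu S r by exact: intg_comb.
have rE : Rintegral mu S r = - (s * Rintegral mu S g).
  by rewrite Rintegral_comb// kf; lra.
have rB x : S x -> `|r x| <= B.
  move=> Sx; have := kB x Sx; congr (`|_| <= _).
  by rewrite /r; lra.
rewrite -normrN -rE (le_trans (le_normr_Rintegral mS ri))//.
rewrite -(Rintegral_cst mu mS B); apply: le_Rintegral => //.
- exact: (integrable_norm ri).
- by apply: (@intg_bounded _ _ _ mu S mS muS _ `|B|).
Qed.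

(** * Plane rotations *)

Section rotation.
Variables (i j : 'I_n).
Hypothesis ij : i != j.

Definition rotation (c s : R) x : 'rV[R]_n := \row_k
  (if k == i then c * x ord0 i - s * x ord0 j
   else if k == j then s * x ord0 i + c * x ord0 j else x ord0 k).

Lemma rotationE c s x k : rotation c s x ord0 k =
  if k == i then c * x ord0 i - s * x ord0 j
  else if k == j then s * x ord0 i + c * x ord0 j else x ord0 k.
Proof. by rewrite mxE. Qed.

Lemma rotationK c s : c ^+ 2 + s ^+ 2 = 1 ->
  cancel (rotation c s) (rotation c (- s)).
Proof.
move=> cs x; apply/rowP => k.
change (rotation c (- s) (rotation c s x) ord0 k = x ord0 k).
rewrite !rotationE !eqxx (eq_sym j i) (negbTE ij).
have cs' (a : R) : (c ^+ 2 + s ^+ 2) * a = a by rewrite cs mul1r.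
case: eqP => [->|_]; first by rewrite -[RHS]cs'; ring.
by case: eqP => [->|//]; rewrite -[RHS]cs'; ring.
Qed.

Lemma rotationB c s x y : rotation c s (x - y) = rotation c s x - rotation c s y.
Proof.
apply/rowP => k; rewrite !mxE; case: ifP => _; first by ring.
by case: ifP => _ //; ring.
Qed.

Lemma enorm_rotation c s x : c ^+ 2 + s ^+ 2 = 1 -> enorm (rotation c s x) = enorm x.
Proof.
move=> cs; rewrite /enorm; congr Num.sqrt.
have split2 (F : 'I_n -> R) : \sum_k F k =
    F i + F j + \sum_(k | (k != i) && (k != j)) F k.
  by rewrite (bigD1 i)//= (bigD1 j) 1?eq_sym//= addrA.
rewrite !split2 !rotationE !eqxx (eq_sym j i) (negbTE ij); congr (_ + _).
  rewrite -[RHS]mul1r -cs; ring.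
by apply: eq_bigr => k /andP[/negbTE ki /negbTE kj]; rewrite rotationE ki kj.
Qed.

Lemma sphere_rotation c s x : c ^+ 2 + s ^+ 2 = 1 -> S x -> S (rotation c s x).
Proof. by move=> cs; rewrite /sphere /= enorm_rotation. Qed.

Definition rotation_defect u c s x : C :=
  reval u (rotation c s x) - reval u x - s%:C * reval (rotgen i j u) x.

(** The class of polynomials with such an expansion contains the coordinates,
    since 1 - c <= s^2, and is closed under sums and products. *)
Lemma rotation_taylor u : exists2 M : R, 0 <= M & forall x c s,
  S x -> 0 <= c -> c ^+ 2 + s ^+ 2 = 1 ->
  `|rotation_defect u c s x| <= (M * s ^+ 2)%:C.
Proof.
elim/mpoly_ring_ind: u => [a|k|u v [M M0 uM] [N N0 vN]|u v [M M0 uM] [N N0 vN]].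
- exists 0 => // x c s _ _ _; rewrite /rotation_defect !revalC subrr sub0r.
  by rewrite rotgenC (reval_nat 0) mulr0 oppr0 normr0 mul0r.
- exists 1 => // x c s Sx c0 cs; rewrite mul1r /rotation_defect.
  rewrite -[mpolyX _ _]/(varX R k) !revalX rotationE rotgenX revalB !revalM !revalX.
  have c1 : `|c - 1| <= s ^+ 2.
    have c_le1 : c <= 1 by have := sqr_ge0 s; nra.
    by rewrite ler0_norm ?subr_le0//; nra.
  have key (l : 'I_n) : `|((c - 1) * x ord0 l)%:C : C| <= (s ^+ 2)%:C.
    rewrite normc_real lecR normrM -[leRHS]mulr1 ler_pM//.
    exact: sphere_coord.
  have pvb (b : bool) : reval b%:R x = (b%:R : R)%:C.
    by rewrite reval_nat rmorph_nat.
  rewrite !pvb (eq_sym j); case: eqP => [->|ki].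
    rewrite eqxx (negbTE ij) /= -!rmorphM -!rmorphB/= -!rmorphM -!rmorphB/=.
    by move: (key i); congr (`| _%:C | <= _); ring.
  case: eqP => [->|kj]; rewrite -!rmorphM -!rmorphB/= -!rmorphM -!rmorphB/=.
    rewrite (negbTE ij) /=.
    by move: (key j); congr (`| _%:C | <= _); ring.
  rewrite (_ : _ - _ = 0) ?normr0 ?lecR ?sqr_ge0//.
  by rewrite (_ : (i == k) = false) /=; [ring|apply/eqP => ik; exact: ki].
- exists (M + N) => [|x c s Sx c0 cs]; first exact: addr_ge0.
  rewrite (_ : rotation_defect (u + v) c s x =
    rotation_defect u c s x + rotation_defect v c s x); last first.
    rewrite /rotation_defect.
    rewrite rotgenD.
    rewrite (revalD u v) (revalD u v) (revalD (rotgen i j u)).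
    exact: defectD.
  rewrite mulrDl rmorphD/= (le_trans (ler_normD _ _))// lerD ?uM ?vN//.
- have [B1 B10 uB] := reval_bounded u; have [B2 B20 vB] := reval_bounded v.
  have [B3 B30 u'B] := reval_bounded (rotgen i j u).
  have [B4 B40 v'B] := reval_bounded (rotgen i j v).
  exists (B3 * B4 + M * B2 + (B1 + B3) * N) => [|x c s Sx c0 cs].
    by rewrite !addr_ge0// ?mulr_ge0// addr_ge0.
  have s1 : `|s| <= 1.
    by rewrite -ler_sqr ?nnegrE// real_normK ?num_real// expr1n -cs lerDr sqr_ge0.
  set a := reval (rotgen i j u) x; set b := reval (rotgen i j v) x.
  have -> : rotation_defect (u * v) c s x =
      (s ^+ 2)%:C * (a * b) + rotation_defect u c s x * reval v (rotation c s x)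
      + (reval u x + s%:C * a) * rotation_defect v c s x.
    by rewrite /rotation_defect rotgenM revalD !revalM rmorphXn; exact: defectM.
  have -> : ((B3 * B4 + M * B2 + (B1 + B3) * N) * s ^+ 2)%:C =
      (s ^+ 2)%:C * (B3%:C * B4%:C) + (M * s ^+ 2)%:C * B2%:C
      + (B1%:C + B3%:C) * (N * s ^+ 2)%:C :> C.
    by rewrite -!(rmorphM, rmorphD)/=; congr (_%:C); ring.
  have Srx := sphere_rotation cs Sx.
  apply: defect_bound.
  - by rewrite normc_real (ger0_norm (sqr_ge0 s)).
  - exact: u'B.
  - exact: v'B.
  - exact: uM.
  - exact: vB.
  - exact: uB.
  - by rewrite normc_real lecR.
  - exact: vN.
Qed.

Lemma measurable_rotation c s : c ^+ 2 + s ^+ 2 = 1 ->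
  measurable_fun setT (rotation c s : V -> V).
Proof.
move=> cs; apply: measurable_isometry => x y.
by rewrite -rotationB enorm_rotation.
Qed.

Lemma Rintegral_reval_rotation u c s : c ^+ 2 + s ^+ 2 = 1 ->
  intg mu S (fun x : V => complex.Re (reval u (rotation c s x))) /\
  Rintegral mu S (fun x : V => complex.Re (reval u (rotation c s x))) =
  Rintegral mu S (fun x : V => complex.Re (reval u x)).
Proof.
move=> cs; have [m1 _] := measurable_reval u; have [M M0 uM] := reval_bounded u.
have ig : intg mu S (fun x : V => complex.Re (reval u (rotation c s x))).
  apply: (@intg_bounded _ _ _ mu S mS muS _ M).
    apply: measurable_funTS; apply: (measurableT_comp m1).
    exact: measurable_rotation.
  by move=> x Sx; apply/normc_Re/uM/sphere_rotation.
split; first exact: ig.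
have cs' : c ^+ 2 + (- s) ^+ 2 = 1 by rewrite sqrrN.
have rK : cancel (rotation c (- s)) (rotation c s).
  by have := rotationK cs'; rewrite opprK.
have rd x y : enorm (rotation c s x - rotation c s y) = enorm (x - y).
  by rewrite -rotationB enorm_rotation.
have rn x : enorm (rotation c s x) = enorm x by rewrite enorm_rotation.
exact: (Rintegral_isometry rK rd rn m1 ig).
Qed.

(** The integral does not change under rotations, so the first-order term of
    its variation, s times the integral of the derivative, is of order s^2. *)
Lemma Re_sphere_mean_rotgen u : complex.Re (sphere_mean (rotgen i j u)) = 0.
Proof.
have [M M0 uM] := rotation_taylor u.
pose a := complex.Re (sphere_mean (rotgen i j u)); pose m := fine (mu S).
have m0 : 0 <= m by exact: fine_ge0.
have bound s : 0 < s -> s <= 1 -> `|s * a| <= M * s ^+ 2 * m.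
  move=> s0 s1; pose c := Num.sqrt (1 - s ^+ 2).
  have cs : c ^+ 2 + s ^+ 2 = 1.
    by rewrite sqr_sqrtr ?subrK// subr_ge0 expr_le1// ltW.
  have [ir Er] := Rintegral_reval_rotation u cs.
  have [iu _] := cintg_reval u; have [iD _] := cintg_reval (rotgen i j u).
  rewrite /a Re_sphere_mean /m; apply: (Rintegral_first_order iu iD ir Er) => x Sx.
  have := normc_Re (uM x c s Sx (sqrtr_ge0 _) cs).
  congr (`|_| <= _); rewrite /rotation_defect.
  by move: (reval u x) (reval (rotgen i j u) x) (reval u _) => [? ?] [? ?] [? ?] /=; ring.
exact: (first_order_eq0 M0 m0 bound).
Qed.

End rotation.

Lemma sphere_mean_rotgen i j u : sphere_mean (rotgen i j u) = 0.
Proof.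
have [->|ij] := eqVneq i j; first by rewrite rotgen_id -(scale0r 0) sphere_meanZ mul0r.
have := Re_sphere_mean_rotgen ij u; have := Re_sphere_mean_rotgen ij ((- 'i%C) *: u).
rewrite rotgenZ sphere_meanZ; case: (sphere_mean _) => a b /=.
by rewrite oppr0 !mul0r => h1 h2; congr (_ +i* _); lra.
Qed.

(** * Orthogonality of harmonic polynomials *)

(** Integration by parts: the derivation has integral 0 on the product. *)
Lemma sphere_mean_rotgen_adj i j u v :
  sphere_mean (rotgen i j u * v) = - sphere_mean (u * rotgen i j v).
Proof.
by apply/eqP; rewrite -addr_eq0 -sphere_meanD -rotgenM sphere_mean_rotgen.
Qed.

Local Notation homog d u := (u \is ishomog1 d mdeg).

Lemma sphere_mean_casimir_adj u v : sphere_mean (casimir u * v) = sphere_mean (u * casimir v).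
Proof.
rewrite /casimir mulr_suml mulr_sumr !sphere_mean_sum; apply: eq_bigr => i _.
rewrite mulr_suml mulr_sumr !sphere_mean_sum; apply: eq_bigr => j _.
have E1 := sphere_mean_rotgen_adj i j (rotgen i j u) v.
have E2 := sphere_mean_rotgen_adj i j u (rotgen i j v).
exact: (etrans E1 (etrans (congr1 -%R E2) (opprK _))).
Qed.
Opaque casimir.

(** Eigenvectors of a symmetric operator for distinct eigenvalues. *)
Lemma harmonic_orthogonal a b u v : (2 <= n)%N -> homog a u -> homog b v ->
  laplacian u = 0 -> laplacian v = 0 -> a != b -> sphere_mean (u * v) = 0.
Proof.
move=> n2 hu hv u0 v0 ab.
have lam (k : nat) : k%:R * (k%:R + n%:R - 2) = (k * (k + (n - 2)))%:R :> C.
  by rewrite natrM natrD natrB// addrA.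
have := casimirE hu; have := casimirE hv.
rewrite u0 v0 !mulr0 !sub0r !lam => Ev Eu.
have := sphere_mean_casimir_adj u v.
have AB : (a * (a + (n - 2)))%N != (b * (b + (n - 2)))%N.
  by apply/eqP => E; case: (ltngtP a b) ab => // lt _; nia.
move: Ev Eu AB; move: (a * _)%N (b * _)%N => A B Ev Eu AB.
rewrite Eu.
rewrite Ev.
rewrite (eigen_mull A%:R u v) (eigen_mulr B%:R u v) (sphere_meanZ _ (u * v)).
rewrite (sphere_meanZ _ (u * v)); exact: eigen_separation AB.
Qed.

(** The antipodal map is an isometry. *)
Lemma Rintegral_odd (f : V -> R) : measurable_fun setT f -> intg mu S f ->
  (forall x, f (- x) = - f x) -> Rintegral mu S f = 0.
Proof.
move=> mf fi fN.
have oK : cancel (-%R : 'rV[R]_n -> 'rV[R]_n) -%R by exact: opprK.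
have od x y : enorm (- x - - y) = enorm (x - y).
  rewrite -opprD /enorm; congr Num.sqrt; apply: eq_bigr => i _.
  by rewrite mxE sqrrN.
have on x : enorm (- x) = enorm x.
  by rewrite /enorm; congr Num.sqrt; apply: eq_bigr => i _; rewrite mxE sqrrN.
have E : (f \o (-%R : 'rV[R]_n -> 'rV[R]_n)) = (fun x => -1 * f x).
  by apply/funext => x /=; rewrite fN mulN1r.
have := Rintegral_isometry oK od on mf; rewrite E => /(_ (intgZ mS (-1) fi)).
by rewrite RintegralZl//; lra.
Qed.

Lemma sphere_mean_odd d u : odd d -> homog d u -> sphere_mean u = 0.
Proof.
move=> od hu; have [m1 m2] := measurable_reval u; have [i1 i2] := cintg_reval u.
have puN x : reval u (- x) = - reval u x.
  by rewrite (reval_homogN _ hu) -signr_odd od mulN1r.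
have := Re_sphere_mean u; have := Im_sphere_mean u; case: (sphere_mean u) => a b /= -> ->.
by rewrite !Rintegral_odd// => x; rewrite puN; case: (reval u x).
Qed.

End sphere_polynomials.

Section rotated.
Context (R : realType) (n p : nat).
Local Notation C := R[i].
Local Notation S := (sphere R n).
Local Notation mu := (surface_measure R n).
Local Notation V := (borel_rV R n).
Local Notation J := (@sphere_integral R n).
Local Notation homog d u := (u \is ishomog1 d mdeg).
Local Notation F := ('rV[C]_n -> C).
Local Notation H m := (@spherical_polyharmonic R n p m).
Local Notation ip := (@L2_inner R n p).
Local Notation rot k x := (phase p k x).
Implicit Types (f g h : F) (u v : mpoly n C) (x : 'rV[R]_n).
Hypothesis p_gt0 : (0 < p)%N.

(** * Roots of unity *)

Lemma expiD (a b : R) : expi (a + b) = expi a * expi b.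
Proof. by rewrite /expi cosD sinD; simpc; congr (_ +i* _); ring. Qed.

Lemma expiMn (a : R) k : expi (k%:R * a) = expi a ^+ k.
Proof.
elim: k => [|k IH]; first by rewrite mul0r /expi cos0 sin0 expr0.
by rewrite -natr1 mulrDl mul1r expiD IH exprSr.
Qed.

Lemma expi_conj (a : R) : expi a * (expi a)^*%R = 1.
Proof.
rewrite -[(expi a)^*%R]/(conjc _) /expi /=; simpc.
by rewrite -!expr2 cos2Dsin2; congr (_ +i* _); ring.
Qed.

(** The p-th root of -1 that rotates each sphere onto the next one. *)
Definition zeta : C := expi (pi / p%:R).

Lemma expi_phase k : expi (k%:R * pi / p%:R) = zeta ^+ k.
Proof. by rewrite -mulrA expiMn. Qed.

Lemma zeta_expp : zeta ^+ p = -1.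
Proof.
rewrite -expiMn mulrCA divff ?pnatr_eq0 -?lt0n// mulr1 /expi cospi sinpi.
by rewrite -[RHS]/(- 1 +i* - 0) oppr0.
Qed.

(** With t the argument of zeta^k, t/2 lies strictly between 0 and pi, and cos
    t = 1 - 2 sin(t/2)^2. *)
Lemma zeta_neq1 k : (0 < k < 2 * p)%N -> zeta ^+ k != 1.
Proof.
move=> /andP[k0 kp]; rewrite -expiMn; apply/eqP => -[c1 _].
set t := k%:R * (pi / p%:R) in c1.
have p0 : 0 < p%:R :> R by rewrite ltr0n.
have t2 : 0 < t / 2 < pi.
  apply/andP; split.
    by rewrite !(mulr_gt0, divr_gt0) ?ltr0n ?pi_gt0 ?invr_gt0.
  rewrite /t mulrCA -!mulrA gtr_pMr ?pi_gt0//.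
  rewrite -invfM ltr_pdivrMr ?mul1r ?mulr_gt0 ?ltr0n//.
  by rewrite -natrM ltr_nat mulnC.
have := sin_gt0_pi t2; have := cos2Dsin2 (t / 2).
have : cos t = cos (t / 2) ^+ 2 - sin (t / 2) ^+ 2.
  by rewrite {1}(splitr t) cosD !expr2.
by rewrite c1; nra.
Qed.

Lemma zeta_conj : zeta * zeta^*%R = 1.
Proof. exact: expi_conj. Qed.

Lemma sum_expr_root (q : C) : q ^+ p = 1 -> q != 1 -> \sum_(j < p) q ^+ j = 0.
Proof.
move=> qp q1; have := subrX1 q p; rewrite qp subrr => /esym/eqP.
by rewrite mulf_eq0 subr_eq0 (negbTE q1) => /eqP.
Qed.

Lemma zeta_pairE j m k : (k <= m)%N ->
  (zeta ^+ j) ^+ m * ((zeta ^+ j) ^+ k)^*%R = (zeta ^+ (m - k)) ^+ j.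
Proof.
move=> km; rewrite -{1}(subnK km) exprD -mulrA -!exprM rmorphXn -exprMn.
by rewrite zeta_conj expr1n mulr1 mulnC.
Qed.

Lemma sum_zeta_pair m k : (k < m < k + 2 * p)%N -> ~~ odd (m + k) ->
  \sum_(j < p) (zeta ^+ j) ^+ m * ((zeta ^+ j) ^+ k)^*%R = 0.
Proof.
move=> /andP[km mk] ev; under eq_bigr do rewrite zeta_pairE ?(ltnW km)//.
apply: sum_expr_root; last by apply: zeta_neq1; lia.
rewrite -exprM mulnC exprM zeta_expp -signr_odd.
by rewrite oddB ?(ltnW km)// -oddD (negbTE ev).
Qed.

(** * The space of square-integrable functions *)

Let mS : measurable (S : set V) := @measurable_sphereV R n.
Let muS : (mu S < +oo)%E := surface_measure_lty S.

Definition csqint (h : 'rV[R]_n -> C) :=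
  sqint mu S (fun x : V => complex.Re (h x)) /\
  sqint mu S (fun x : V => complex.Im (h x)).

Lemma sqint_eq (a b : V -> R) : (forall x, S x -> a x = b x) ->
  sqint mu S b -> sqint mu S a.
Proof.
move=> ab [mb ib]; split.
  by apply: eq_measurable_fun mb => x /set_mem Sx; rewrite ab.
apply: eq_integrable ib => // x /set_mem Sx; by rewrite /= ab.
Qed.

Lemma csqint_eq (a b : 'rV[R]_n -> C) : (forall x, S x -> a x = b x) ->
  csqint b -> csqint a.
Proof.
by move=> ab [b1 b2]; split; [apply: sqint_eq b1|apply: sqint_eq b2] => x Sx;
  rewrite ab.
Qed.

Lemma csqintL a (h g : 'rV[R]_n -> C) : csqint h -> csqint g ->
  csqint (fun x => a * h x + g x).
Proof.
case: a => a b [h1 h2] [g1 g2]; have [E1 E2] := cplx_combE a b h g.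
by split; rewrite ?E1 ?E2; do ?apply: (sqintD mS) => //; exact: sqintZ.
Qed.

Lemma csqintM (h g : 'rV[R]_n -> C) : csqint h -> csqint g ->
  cintg (fun x => h x * (g x)^*%R).
Proof.
move=> [h1 h2] [g1 g2]; split.
  have -> : (fun x : V => complex.Re (h x * (g x)^*%R)) =
      (fun x => complex.Re (h x) * complex.Re (g x) +
                complex.Im (h x) * complex.Im (g x)).
    by apply/funext => x; case: (h x) (g x) => [a b] [c d] /=; ring.
  by apply: (intgD mS); apply: (sqintM mS).
have -> : (fun x : V => complex.Im (h x * (g x)^*%R)) =
    (fun x => complex.Im (h x) * complex.Re (g x) -
              complex.Re (h x) * complex.Im (g x)).
  by apply/funext => x; case: (h x) (g x) => [a b] [c d] /=; ring.
by apply: (intgB mS); apply: (sqintM mS).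
Qed.

Lemma csqint_reval u : csqint (reval u).
Proof.
have [m1 m2] := measurable_reval u; have [M M0 uM] := reval_bounded u.
split; apply: (@sqint_bounded _ _ _ mu S mS muS _ M).
- exact: measurable_funTS.
- by move=> x Sx; apply: normc_Re; exact: uM.
- exact: measurable_funTS.
- by move=> x Sx; apply: normc_Im; exact: uM.
Qed.

Lemma Re_normc2 (z : C) :
  complex.Re `|z| ^+ 2 = complex.Re z ^+ 2 + complex.Im z ^+ 2.
Proof. by rewrite normc_def /= sqr_sqrtr// addr_ge0 ?sqr_ge0. Qed.

Lemma intg_sum (I : Type) (r : seq I) (g : I -> V -> R) :
  (forall k, intg mu S (g k)) -> intg mu S (fun x => \sum_(k <- r) g k x).
Proof.
move=> gi; elim: r => [|k r IH].
  under eq_fun do rewrite big_nil.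
  by apply: (@intg_bounded _ _ _ mu S mS muS _ 0) => // x _; rewrite normr0.
by under eq_fun do rewrite big_cons; exact: (intgD mS).
Qed.

Lemma cintg_sum (I : Type) (r : seq I) (g : I -> 'rV[R]_n -> C) :
  (forall k, cintg (g k)) -> cintg (fun x => \sum_(k <- r) g k x).
Proof.
move=> gi; elim: r => [|k r IH].
  have -> : (fun x => \sum_(k <- [::]) g k x) = reval (0 : mpoly n C).
    by apply/funext => x; rewrite big_nil (reval_nat 0 x).
  exact: cintg_reval.
have -> : (fun x => \sum_(i <- k :: r) g i x) =
    (fun x => 1 * g k x + \sum_(i <- r) g i x).
  by apply/funext => x; rewrite big_cons mul1r.
exact: cintgL.
Qed.

Let sumsq f x : R := \sum_(k < p) complex.Re `|f (rot k x)| ^+ 2.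

Let sumsq_ge0 f x : 0 <= sumsq f x.
Proof. by apply: sumr_ge0 => k _; exact: sqr_ge0. Qed.

(** On each of the spheres separately the space is the usual one, so everything
    reduces to square-integrable functions on the unit sphere. *)
Lemma L2P f : L2 p f <-> forall k, (k < p)%N -> csqint (fun x => f (rot k x)).
Proof.
pose G : V -> R := sumsq f.
have G_ge (k : 'I_p) x : complex.Re `|f (rot k x)| ^+ 2 <= G x.
  by rewrite /G /sumsq (bigD1 k)//= lerDl sumr_ge0// => i _; exact: sqr_ge0.
have absG : (\int[mu]_(x in S) `|(G x)%:E| = \int[mu]_(x in S) (G x)%:E)%E.
  by apply: eq_integral => x _; rewrite gee0_abs// lee_fin sumsq_ge0.
split=> [[mf fi] k kp|fi].
  have mG : measurable_fun (S : set V) G.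
    apply: measurable_sum => i; under eq_fun do rewrite Re_normc2.
    by have [m1 m2] := mf i (ltn_ord i); apply: measurable_funD;
      exact: measurable_funX.
  have iG : intg mu S G.
    by apply/integrableP; split; [exact/measurable_EFinP|rewrite absG].
  have [m1 m2] := mf k kp.
  split; split => //; apply: (intg_le mS _ iG).
  - exact: measurable_funX.
  - move=> x _; apply: le_trans (G_ge (Ordinal kp) x).
    by rewrite Re_normc2 ger0_norm ?sqr_ge0// lerDl sqr_ge0.
  - exact: measurable_funX.
  - move=> x _; apply: le_trans (G_ge (Ordinal kp) x).
    by rewrite Re_normc2 ger0_norm ?sqr_ge0// lerDr sqr_ge0.
split; first by move=> k /fi[[m1 _] [m2 _]].
have iG : intg mu S G.
  apply: intg_sum => k; under eq_fun do rewrite Re_normc2.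
  by have [[_ i1] [_ i2]] := fi k (ltn_ord k); exact: (intgD mS).
by move: iG => /integrableP[_]; rewrite absG.
Qed.

Lemma L2_linear a f g : L2 p f -> L2 p g -> L2 p (a *: f + g).
Proof.
move=> /L2P fi /L2P gi; apply/L2P => k kp.
exact: csqintL (fi k kp) (gi k kp).
Qed.

Lemma L2_0 : L2 p (0 : F).
Proof.
apply/L2P => k kp; have := csqint_reval (0 : mpoly n C).
by apply: csqint_eq => x Sx; rewrite (reval_nat 0 x).
Qed.

Definition pairing f g x : C := \sum_(k < p) f (rot k x) * (g (rot k x))^*%R.

Lemma L2_innerE f g : ip f g = p%:R^-1 * J (pairing f g).
Proof. by []. Qed.

Lemma cintg_pairing f g : L2 p f -> L2 p g -> cintg (pairing f g).
Proof.
move=> /L2P fi /L2P gi; apply: cintg_sum => k.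
exact: csqintM (fi k (ltn_ord k)) (gi k (ltn_ord k)).
Qed.

Lemma L2_inner_linear a f g h : L2 p f -> L2 p g -> L2 p h ->
  ip (a *: f + g) h = a * ip f h + ip g h.
Proof.
move=> fi gi hi; rewrite !L2_innerE mulrCA -mulrDr; congr (_ * _).
rewrite -sphere_integralL; [|exact: cintg_pairing..].
apply: eq_sphere_integral => x _; rewrite /pairing mulr_sumr -big_split /=.
by apply: eq_bigr => k _; rewrite mulrA -mulrDl.
Qed.

Lemma L2_inner_conj f g : L2 p f -> L2 p g -> ip g f = (ip f g)^*%R.
Proof.
move=> fi gi; rewrite !L2_innerE rmorphM fmorphV rmorph_nat; congr (_ * _).
rewrite -[RHS]/((J (pairing f g))^*%R) -sphere_integral_conj; last exact: cintg_pairing.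
apply: eq_sphere_integral => x _; rewrite /pairing rmorph_sum.
by apply: eq_bigr => k _; rewrite rmorphM /= conjCK mulrC.
Qed.

Lemma L2_inner_ge0 f : L2 p f -> 0 <= ip f f.
Proof.
move=> fi; rewrite L2_innerE mulr_ge0 ?invr_ge0//.
apply: sphere_integral_ge0 => x _; apply: sumr_ge0 => k _.
exact: mul_conjC_ge0.
Qed.

Lemma pairing_sumsq f x : pairing f f x = (sumsq f x)%:C.
Proof.
rewrite /pairing /sumsq rmorph_sum; apply: eq_bigr => k _.
rewrite -normCK [RHS]rmorphXn.
exact: (esym (congr1 (fun z : C => z ^+ 2) (RRe_real (normr_real _)))).
Qed.

Lemma Re_L2_inner f :
  complex.Re (ip f f) = p%:R^-1 * Rintegral mu S (sumsq f : V -> R).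
Proof.
rewrite L2_innerE.
have -> : J (pairing f f) = (Rintegral mu S (sumsq f : V -> R))%:C.
  rewrite /sphere_integral; congr (_ +i* _).
    by apply: eq_Rintegral => x _; rewrite pairing_sumsq.
  transitivity (Rintegral mu S (cst 0 : V -> R)); last first.
    by rewrite Rintegral_cst ?mul0r.
  by apply: eq_Rintegral => x _; rewrite pairing_sumsq.
by rewrite -(rmorph_nat (real_complex R)) -fmorphV -rmorphM.
Qed.

(** The norm is the integral of a nonnegative function. *)
Lemma L2_null f g : L2 p f -> L2 p g -> hnorm ip (f - g) = 0 -> L2_eq p f g.
Proof.
move=> fi gi; have di : L2 p (f - g).
  by rewrite addrC -scaleN1r; exact: L2_linear.
rewrite /hnorm Re_L2_inner; set d := f - g => /eqP; rewrite sqrtr_eq0.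
rewrite pmulr_rle0 ?invr_gt0 ?ltr0n// => I0.
have iG : intg mu S (sumsq d).
  apply: intg_sum => k; under eq_fun do rewrite Re_normc2.
  have /L2P/(_ k (ltn_ord k))[[_ i1] [_ i2]] := di; exact: (intgD mS).
have J0 : (\int[mu]_(x in S) `|(sumsq d x)%:E| = 0)%E.
  under eq_integral do rewrite gee0_abs ?lee_fin ?sumsq_ge0//.
  apply: le_anti; rewrite integral_ge0 => [|x _]; last by rewrite lee_fin sumsq_ge0.
  rewrite andbT; move: I0; rewrite /Rintegral -lee_fin fineK//.
  exact: integrable_fin_num.
have mG : measurable_fun (S : set V) (fun x : V => (sumsq d x)%:E).
  exact: measurable_int iG.
have /(ae_eq_integral_abs mu mS mG) := J0.
apply: filterS => x /= h Sx k kp; have := h Sx => -[] /eqP.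
rewrite psumr_eq0 => [|i _]; last exact: sqr_ge0.
move=> /allP/(_ (Ordinal kp)); rewrite mem_index_enum => /(_ isT) /=.
rewrite Re_normc2 paddr_eq0 ?sqr_ge0// !sqrf_eq0 => /andP[/eqP r0 /eqP i0].
apply/eqP; rewrite -subr_eq0; apply/eqP.
have -> : f (rot k x) - g (rot k x) = d (rot k x) by [].
by case: (d (rot k x)) r0 i0 => a b /= -> ->.
Qed.

(** * Polynomials on the rotated spheres *)

Definition ceval u (z : 'rV[C]_n) : C := meval (fun j => z ord0 j) u.

Lemma meval_scale (c : C) u : exists v, forall z : 'I_n -> C,
  meval (fun i => c * z i) u = meval z v.
Proof.
elim/mpoly_ring_ind: u => [a|i|u v [u' uE] [v' vE]|u v [u' uE] [v' vE]].
- by exists (mpolyC n a) => z; rewrite !mevalC.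
- by exists (c *: varX R i) => z; rewrite mevalZ !mevalXU.
- by exists (u' + v') => z; rewrite !mevalD uE vE.
- by exists (u' * v') => z; rewrite !mevalM uE vE.
Qed.

Lemma phaseE k x j : rot k x ord0 j = zeta ^+ k * (x ord0 j)%:C.
Proof. by rewrite !mxE expi_phase. Qed.

Lemma ceval_phase u k x :
  ceval u (rot k x) = meval (fun j => zeta ^+ k * (x ord0 j)%:C) u.
Proof. by apply: meval_eq => j; rewrite phaseE. Qed.

Lemma ceval_phase_homog d u k x : homog d u ->
  ceval u (rot k x) = (zeta ^+ k) ^+ d * reval u x.
Proof. by move=> hu; rewrite ceval_phase (meval_homog _ _ hu). Qed.

Lemma ceval_phase_reval u k : exists v, forall x, ceval u (rot k x) = reval v x.
Proof.
have [v vE] := meval_scale (zeta ^+ k) u.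
by exists v => x; rewrite ceval_phase vE.
Qed.

Lemma reval_ceval_phase u k : exists v, forall x, ceval v (rot k x) = reval u x.
Proof.
have [v vE] := meval_scale ((zeta ^+ k)^*%R) u; exists v => x.
rewrite ceval_phase -vE /reval; apply: meval_eq => j.
have ck : (zeta ^+ k)^*%R * zeta ^+ k = 1.
  by rewrite mulrC rmorphXn /= -exprMn zeta_conj expr1n.
by rewrite mulrA ck mul1r.
Qed.

Lemma ceval_linear a u v : ceval (a *: u + v) = a *: ceval u + ceval v :> F.
Proof. by apply/funext => z; rewrite /ceval mevalD mevalZ. Qed.

Lemma L2_ceval u : L2 p (ceval u).
Proof.
apply/L2P => k kp; have [v vE] := ceval_phase_reval u k.
by apply: csqint_eq (csqint_reval v) => x _; rewrite vE.
Qed.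

Lemma L2_eq_on f g : (forall z, rotated_spheres p z -> f z = g z) ->
  L2 p g -> L2 p f.
Proof.
move=> fg /L2P gi; apply/L2P => k kp; apply: csqint_eq (gi k kp) => x Sx.
by apply: fg; exists k => //; exists x.
Qed.

Lemma L2_inner_eq f f' g g' :
  (forall z, rotated_spheres p z -> f z = f' z) ->
  (forall z, rotated_spheres p z -> g z = g' z) -> ip f g = ip f' g'.
Proof.
move=> ff gg; rewrite !L2_innerE; congr (_ * _).
apply: eq_sphere_integral => x Sx; apply: eq_bigr => k _.
have Sk : rotated_spheres p (rot k x) by exists (k : nat); [exact: ltn_ord|exists x].
by rewrite ff// gg.
Qed.

Lemma polyharmonic_linear m a u v : polyharmonic p m u -> polyharmonic p m v ->
  polyharmonic p m (a *: u + v).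
Proof.
move=> [hu u0] [hv v0]; split; first by rewrite rpredD// dhomogZ.
by rewrite iter_laplacianD iter_laplacianZ u0 v0 scaler0 addr0.
Qed.

Lemma spherical_linear m : linear_set (H m).
Proof.
split.
  exists 0; first by split; [exact: dhomog0|exact: iter_laplacian0].
  by move=> z _; rewrite meval0.
move=> a f g [u hu fu] [v hv gv].
exists (a *: u + v); first exact: polyharmonic_linear.
by move=> z Sz; rewrite mevalD mevalZ -fu// -gv.
Qed.

Lemma spherical_L2 m : H m `<=` L2 p.
Proof. by move=> f [u _ fu]; apply: L2_eq_on fu _; exact: L2_ceval. Qed.

(** Up to values off the rotated spheres the space consists of restrictions of
    polynomials of bounded degree, and these are spanned by finitely many
    monomials. *)
Lemma spherical_proj m f : L2 p f -> exists y, is_proj ip (H m) f y.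
Proof.
pose W := [set g : F | exists2 u, polyharmonic p m u & g = ceval u].
have WH : W `<=` L2 p by move=> g [u _ ->]; exact: L2_ceval.
have linW : linear_set W.
  split.
    exists 0; first by split; [exact: dhomog0|exact: iter_laplacian0].
    by apply/funext => z; rewrite /ceval meval0.
  move=> a _ _ [u hu ->] [v hv ->]; exists (a *: u + v).
    exact: polyharmonic_linear.
  by rewrite ceval_linear.
pose I : finType := bmultinom n m.+1.
pose e (i : 'I_#|I|) : F := ceval (mpolyX C (bmnm (enum_val i))).
have spanW g : W g -> exists c : 'I_#|I| -> C, g = \sum_i c i *: e i.
  move=> [u [hu _] ->]; exists (fun i => mcoeff (bmnm (enum_val i)) u).
  have um : (msize u <= m.+1)%N.
    by rewrite msizeE; apply/bigmax_leqP_seq => k ku _; rewrite (dhomog_mf hu ku).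
  have E := mpolywE um.
  apply/funext => z; rewrite fct_sumE /=.
  have -> : ceval u z = ceval (\sum_(k : I) mcoeff (bmnm k) u *: mpolyX C (bmnm k)) z.
    by rewrite -E.
  rewrite /ceval raddf_sum /=.
  rewrite (reindex (@enum_val I predT)) /=; last first.
    by apply: onW_bij; exact: enum_val_bij.
  by apply: eq_bigr => i _; rewrite mevalZ.
move=> fi.
have [y [Wy fy]] := proj_exists (@L2_0) L2_linear L2_inner_linear
  L2_inner_conj L2_inner_ge0 WH linW spanW fi.
exists y; split; first by case: Wy => u hu ->; exists u.
move=> z [u hu zu]; rewrite -(fy (ceval u)); last by exists u.
by apply: L2_inner_eq.
Qed.

(** * Orthogonality *)

(** On real points this takes the conjugate values, so that the sesquilinear
    pairing becomes the integral of a product of polynomials. *)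
Definition conj_mpoly u : mpoly n C := map_mpoly (Num.conj : C -> C) u.

Lemma mcoeff_conj_mpoly m u : mcoeff m (conj_mpoly u) = (mcoeff m u)^*%R.
Proof. exact: mcoeff_map_mpoly. Qed.

Lemma conj_mpolyC a : conj_mpoly (mpolyC n a) = mpolyC n (a^*%R).
Proof. exact: map_mpolyC. Qed.

Lemma conj_mpolyX m : conj_mpoly (mpolyX C m) = mpolyX C m.
Proof. exact: map_mpolyX. Qed.

Lemma conj_mpolyD u v : conj_mpoly (u + v) = conj_mpoly u + conj_mpoly v.
Proof. exact: raddfD. Qed.

Lemma conj_mpolyM u v : conj_mpoly (u * v) = conj_mpoly u * conj_mpoly v.
Proof. exact: rmorphM. Qed.
Opaque conj_mpoly.

Lemma laplacian_conj u : laplacian (conj_mpoly u) = conj_mpoly (laplacian u).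
Proof.
apply/mpolyP => m; rewrite mcoeff_conj_mpoly /laplacian !raddf_sum.
apply: eq_bigr => j _.
by rewrite /= !mcoeff_mderiv mcoeff_conj_mpoly !rmorphMn.
Qed.

Lemma iter_laplacian_conj k u : iter k (@laplacian R n) (conj_mpoly u) =
  conj_mpoly (iter k (@laplacian R n) u).
Proof.
elim: k => [|k IH]; first by [].
by rewrite [in LHS]iterS IH [in RHS]iterS; exact: laplacian_conj.
Qed.

Lemma polyharmonic_conj m u : polyharmonic p m u ->
  polyharmonic p m (conj_mpoly u).
Proof.
move=> [hu u0]; split.
  apply/dhomogP => k; rewrite mcoeff_msupp mcoeff_conj_mpoly fmorph_eq0.
  by rewrite -mcoeff_msupp; exact: (dhomog_mf hu).
by rewrite iter_laplacian_conj u0; apply/mpolyP => k; rewrite mcoeff_conj_mpoly mcoeff0 conjC0.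
Qed.

Lemma reval_conj u x : reval (conj_mpoly u) x = (reval u x)^*%R.
Proof.
elim/mpoly_ring_ind: u => [a|i|u v uE vE|u v uE vE].
- by rewrite conj_mpolyC (revalC (n := n) a) revalC.
- by rewrite conj_mpolyX revalX -[RHS]/(conjc _) conjc_real.
- transitivity ((reval u x + reval v x)^*%R); last first.
    exact: (congr1 Num.conj (esym (revalD u v x))).
  rewrite rmorphD /= -uE -vE.
  by rewrite conj_mpolyD; exact: revalD.
- transitivity ((reval u x * reval v x)^*%R); last first.
    exact: (congr1 Num.conj (esym (revalM u v x))).
  rewrite rmorphM /= -uE -vE.
  by rewrite conj_mpolyM; exact: revalM.
Qed.

(** By Almansi's decomposition u and v restrict on the sphere to sums of
    harmonic polynomials, of degrees at least m - 2 (p - 1) > k for u and at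
    most k for v. *)
Lemma sphere_pairing_ge2p m k u v : (2 <= n)%N -> (k + 2 * p <= m)%N ->
  polyharmonic p m u -> polyharmonic p k v -> sphere_mean (u * v) = 0.
Proof.
move=> n2 km [hu u0] [hv v0]; have n0 : (0 < n)%N by exact: ltnW.
have [a [ha ->]] := almansi n0 hu u0; have [b [hb ->]] := almansi n0 hv v0.
rewrite mulr_suml sphere_mean_sum; apply: big1 => i _.
rewrite mulr_sumr sphere_mean_sum; apply: big1 => j _.
have [ha1 ha2 _] := ha i; have [hb1 hb2 _] := hb j.
have -> : sqnorm R n ^+ i * a i * (sqnorm R n ^+ j * b j) =
    sqnorm R n ^+ (i + j) * (a i * b j) by rewrite exprD mulrACA.
rewrite sphere_mean_sqnormX; apply: (harmonic_orthogonal n2 ha1 hb1 ha2 hb2).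
by have := ltn_ord i; lia.
Qed.

(** By homogeneity the inner product is the integral of u times the conjugate
    of v, multiplied by the sum of zeta^((m - k) j) over j < p. For m - k odd
    the integral vanishes by antipodal symmetry, for m - k even and less than 2
    p the sum vanishes, and otherwise the degrees are far enough apart. *)
Lemma spherical_orthogonal_lt m k : (2 <= n)%N -> (k < m)%N ->
  orthogonal_sets ip (H m) (H k).
Proof.
move=> n2 km f g [u hu fu] [v hv gv].
rewrite (@L2_inner_eq _ (ceval u) _ (ceval v)) // L2_innerE.
have hv' := polyharmonic_conj hv; set v' := conj_mpoly v in hv'.
have -> : J (pairing (ceval u) (ceval v)) =
    (\sum_(j < p) (zeta ^+ j) ^+ m * ((zeta ^+ j) ^+ k)^*%R) * sphere_mean (u * v').
  pose c := \sum_(j < p) (zeta ^+ j) ^+ m * ((zeta ^+ j) ^+ k)^*%R.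
  rewrite -[in RHS]/c -sphere_meanZ; apply: eq_sphere_integral => x _.
  rewrite revalZ revalM reval_conj /pairing /c mulr_suml; apply: eq_bigr => j _.
  rewrite (ceval_phase_homog _ _ hu.1) (ceval_phase_homog _ _ hv.1).
  by rewrite rmorphM mulrACA.
have [mk|mk] := ltnP m (k + 2 * p); last first.
  by rewrite (sphere_pairing_ge2p n2 mk hu hv') !mulr0.
have [od|ev] := boolP (odd (m + k)).
  rewrite (@sphere_mean_odd _ _ (m + k)%N) ?mulr0//.
  exact: dhomogM hu.1 hv'.1.
by rewrite sum_zeta_pair ?km// mul0r mulr0.
Qed.

Lemma spherical_orthogonal m k : (2 <= n)%N -> m <> k ->
  orthogonal_sets ip (H m) (H k).
Proof.
move=> n2 mk; case: (ltngtP m k) => // lt f g Hf Hg; last first.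
  exact: spherical_orthogonal_lt lt _ _ Hf Hg.
rewrite L2_inner_conj; [|exact: spherical_L2 Hg|exact: spherical_L2 Hf].
by rewrite (spherical_orthogonal_lt n2 lt Hg Hf) conjC0.
Qed.

(** * Density *)

Definition spherical_span : set F := [set f | exists N (w : nat -> F),
  (forall m, H m (w m)) /\
  forall z, rotated_spheres p z -> f z = \sum_(0 <= m < N) w m z].

Lemma spherical_span_pad f N (w : nat -> F) M : (forall m, H m (w m)) ->
  (forall z, rotated_spheres p z -> f z = \sum_(0 <= m < N) w m z) ->
  (N <= M)%N -> exists w' : nat -> F, (forall m, H m (w' m)) /\
  forall z, rotated_spheres p z -> f z = \sum_(0 <= m < M) w' m z.
Proof.
move=> Hw fw NM; exists (fun m => if (m < N)%N then w m else 0); split.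
  by move=> m; case: ifP => _ //; exact: (spherical_linear m).1.
move=> z Sz; rewrite fw// [RHS](big_cat_nat (leq0n _) NM)//=.
rewrite [X in _ + X]big1_seq ?addr0.
  by apply: eq_big_nat => m /andP[_ mN]; rewrite mN.
move=> m /andP[_]; rewrite mem_index_iota => /andP[Nm _].
by rewrite ltnNge Nm.
Qed.

Lemma spherical_spanL a f g : spherical_span f -> spherical_span g ->
  spherical_span (a *: f + g).
Proof.
move=> [N [w [Hw fw]]] [M [t [Ht gt]]].
have [w' [Hw' fw']] := spherical_span_pad Hw fw (leq_maxl N M).
have [t' [Ht' gt']] := spherical_span_pad Ht gt (leq_maxr N M).
exists (maxn N M), (fun m => a *: w' m + t' m); split.
  by move=> m; exact: (spherical_linear m).2.
move=> z Sz; have -> : (a *: f + g) z = a * f z + g z by [].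
rewrite fw'// gt'// mulr_sumr -big_split; exact: eq_bigr.
Qed.

Lemma spherical_span_eq f g : (forall z, rotated_spheres p z -> f z = g z) ->
  spherical_span g -> spherical_span f.
Proof.
move=> fg [N [w [Hw gw]]]; exists N, w; split => // z Sz.
by rewrite fg// gw.
Qed.

Lemma spherical_span_mem m f : H m f -> spherical_span f.
Proof.
move=> Hf; exists m.+1, (fun k => if k == m then f else 0); split.
  by move=> k; case: eqP => [->//|_]; exact: (spherical_linear k).1.
move=> z _; rewrite big_nat_recr//= eqxx big1_seq ?add0r// => k /andP[_].
by rewrite mem_index_iota => /andP[_ km]; rewrite ltn_eqF.
Qed.

Lemma spherical_span_sum (I : Type) (r : seq I) (f : I -> F) :
  (forall i, spherical_span (f i)) -> spherical_span (fun z => \sum_(i <- r) f i z).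
Proof.
move=> hf; elim: r => [|i r IH].
  apply: (spherical_span_eq (g := 0)); first by move=> z _; rewrite big_nil.
  exact: spherical_span_mem (spherical_linear 0).1.
apply: (spherical_span_eq (g := 1 *: f i + (fun z => \sum_(i <- r) f i z))).
  by move=> z _; rewrite big_cons scale1r.
exact: spherical_spanL.
Qed.

Lemma ceval_sqnorm k x : S x -> ceval (sqnorm R n) (rot k x) = zeta ^+ (2 * k).
Proof.
move=> Sx; rewrite (ceval_phase_homog _ _ (homog_sqnorm R n)) reval_sqnorm// mulr1.
by rewrite -exprM mulnC.
Qed.

Lemma ceval_sqnorm_expp z : rotated_spheres p z -> ceval (sqnorm R n) z ^+ p = 1.
Proof.
move=> [k kp [x Sx <-]]; rewrite ceval_sqnorm// -exprM mulnC exprM zeta_expp.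
by rewrite exprM sqrrN !expr1n.
Qed.

Lemma cevalM u v z : ceval (u * v) z = ceval u z * ceval v z.
Proof. exact: mevalM. Qed.

Lemma cevalXn u k z : ceval (u ^+ k) z = ceval u z ^+ k.
Proof. exact: rmorphXn. Qed.

(** Since the p-th power of z.z is 1 on the rotated spheres, the exponent j may
    be reduced modulo p, and then the product is polyharmonic of order p. *)
Lemma spherical_span_sqnorm d u j : homog d u -> laplacian u = 0 ->
  spherical_span (ceval (sqnorm R n ^+ j * u)).
Proof.
move=> hu u0.
apply: (spherical_span_eq (g := ceval (sqnorm R n ^+ (j %% p) * u))).
  move=> z Sz; rewrite !cevalM !cevalXn; congr (_ * _).
  by rewrite {1}(divn_eq j p) exprD mulnC exprM ceval_sqnorm_expp// expr1n mul1r.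
apply: (@spherical_span_mem (2 * (j %% p) + d)).
exists (sqnorm R n ^+ (j %% p) * u) => //; split.
  by apply: dhomogM => //; exact/dhomogMn/homog_sqnorm.
by apply: (iter_laplacian_sqnormX hu u0); rewrite ltn_pmod.
Qed.

Lemma spherical_span_homog d u : (0 < n)%N -> homog d u -> spherical_span (ceval u).
Proof.
move=> n0 hu; have ud : iter d.+1 (@laplacian R n) u = 0.
  by apply: (homog_iter_laplacian hu); lia.
have [h [hh ->]] := almansi n0 hu ud.
apply: (spherical_span_eq
  (g := fun z => \sum_(j <- index_enum 'I_d.+1) ceval (sqnorm R n ^+ j * h j) z)).
  by move=> z _; rewrite /ceval raddf_sum.
apply: spherical_span_sum => j; have [h1 h2 _] := hh j.
exact: spherical_span_sqnorm h1 h2.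
Qed.

Lemma spherical_span_ceval u : (0 < n)%N -> spherical_span (ceval u).
Proof.
move=> n0; apply: (spherical_span_eq
  (g := fun z => \sum_(m <- msupp u) ceval (mcoeff m u *: mpolyX C m) z)).
  by move=> z _; rewrite {1}(mpolyE u) /ceval raddf_sum.
apply: spherical_span_sum => m; apply: (spherical_span_homog (d := mdeg m) n0).
by apply: dhomogZ; rewrite dhomogX.
Qed.

Definition real_poly : set (V -> R) :=
  [set q | exists u, forall x, reval u x = (q x)%:C].

Lemma real_poly_dense (g : V -> R) (e : R) : sqint mu S g -> 0 < e ->
  exists q, real_poly q /\ Rintegral mu S (fun x => (g x - q x) ^+ 2) < e.
Proof.
move=> sg e0; suff [_ /(_ e e0)] : approximable mu S real_poly g by [].
apply: (algebra_dense_L2 mS muS _ _ _ _ _ _ sg).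
- by move=> a; exists (mpolyC n a%:C) => x; rewrite revalC.
- by move=> a b [u uE] [v vE]; exists (u + v) => x; rewrite revalD uE vE rmorphD.
- by move=> a b [u uE] [v vE]; exists (u * v) => x; rewrite revalM uE vE rmorphM.
- move=> q [u uE]; have [m1 _] := measurable_reval u.
  by rewrite (_ : q = fun x => complex.Re (reval u x))//; apply/funext => x; rewrite uE.
- move=> q [u uE]; have [M _ uM] := reval_bounded u; exists M => x Sx.
  by have := normc_Re (uM x Sx); rewrite uE.
- move=> B /borel_halfspaces; apply: sub_sigma_algebra2.
  move=> _ [i [a ->]]; exists (fun x : V => (x : 'rV[R]_n) ord0 i); split.
    by exists (varX R i) => x; rewrite revalX.
  by exists a.
Qed.

Lemma complex_poly_dense (h : 'rV[R]_n -> C) (e : R) : csqint h -> 0 < e ->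
  exists u, csqint (fun x => h x - reval u x) /\
  Rintegral mu S (fun x : V => complex.Re `|h x - reval u x| ^+ 2) < e.
Proof.
move=> sh e0; have e2 : 0 < e / 2 by rewrite divr_gt0.
have [q [[u uE] qe]] := real_poly_dense sh.1 e2.
have [r [[v vE] re]] := real_poly_dense sh.2 e2.
pose w := u + 'i%C *: v; exists w.
have sw : csqint (fun x => h x - reval w x).
  have := csqintL (-1) (csqint_reval w) sh; apply: csqint_eq => x _.
  by rewrite mulN1r addrC.
split => //.
have E x : complex.Re `|h x - reval w x| ^+ 2 =
    (complex.Re (h x) - q x) ^+ 2 + (complex.Im (h x) - r x) ^+ 2.
  rewrite Re_normc2 /w revalD revalZ uE vE; case: (h x) => a b /=.
  by congr (_ ^+ 2 + _ ^+ 2); ring.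
have [[_ i1] [_ i2]] := sw.
have E1 : (fun x : V => (complex.Re (h x) - q x) ^+ 2) =
    (fun x => complex.Re (h x - reval w x) ^+ 2).
  apply/funext => x; rewrite /w revalD revalZ uE vE; case: (h x) => a b /=.
  by congr (_ ^+ 2); ring.
have E2 : (fun x : V => (complex.Im (h x) - r x) ^+ 2) =
    (fun x => complex.Im (h x - reval w x) ^+ 2).
  apply/funext => x; rewrite /w revalD revalZ uE vE; case: (h x) => a b /=.
  by congr (_ ^+ 2); ring.
have -> : Rintegral mu S (fun x : V => complex.Re `|h x - reval w x| ^+ 2) =
    Rintegral mu S (fun x : V => (complex.Re (h x) - q x) ^+ 2 +
      (complex.Im (h x) - r x) ^+ 2).
  by apply: eq_Rintegral => x _; exact: E.
rewrite RintegralD//; [lra|by rewrite E1|by rewrite E2].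
Qed.

(** On the rotated spheres this is the indicator of the k-th one: z.z is
    zeta^(2 j) on the j-th one, and the mean of the powers of a p-th root of
    unity other than 1 is 0. *)
Definition piece (k : nat) : mpoly n C :=
  (p%:R^-1 : C) *: \sum_(l < p) (((zeta ^+ (2 * k))^*%R) *: sqnorm R n) ^+ l.

Lemma ceval_piece j k x : S x -> (j < p)%N -> (k < p)%N ->
  ceval (piece k) (rot j x) = (j == k)%:R.
Proof.
move=> Sx jp kp; set q := (zeta ^+ (2 * k))^*%R * zeta ^+ (2 * j).
have -> : ceval (piece k) (rot j x) = p%:R^-1 * \sum_(l < p) q ^+ l.
  rewrite /piece /ceval mevalZ raddf_sum /=; congr (_ * _).
  apply: eq_bigr => l _; rewrite rmorphXn /= mevalZ.
  by rewrite -[meval _ _]/(ceval (sqnorm R n) (rot j x)) ceval_sqnorm.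
have ck : (zeta ^+ (2 * k))^*%R * zeta ^+ (2 * k) = 1.
  by rewrite mulrC rmorphXn /= -exprMn zeta_conj expr1n.
have [jk|jk] := eqVneq j k.
  rewrite /q jk ck; under eq_bigr do rewrite expr1n.
  by rewrite sumr_const card_ord mulVf// pnatr_eq0 -lt0n.
rewrite sum_expr_root ?mulr0//.
  rewrite /q exprMn -rmorphXn /= -!exprM ![(_ * p)%N]mulnC !exprM zeta_expp.
  by rewrite !sqrrN !expr1n conjC1 mulr1.
apply/eqP => q1; have {q1} E : zeta ^+ (2 * j) = zeta ^+ (2 * k).
  by rewrite -[RHS]mulr1 -q1 /q mulrA [_ * _^*%R]mulrC ck mul1r.
have w0 : zeta != 0.
  by apply/eqP => w0; have := zeta_conj; rewrite w0 mul0r => /eqP; rewrite eq_sym oner_eq0.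
have aux a b : (a < b < p)%N -> zeta ^+ (2 * a) != zeta ^+ (2 * b).
  move=> /andP[ab bp]; apply/eqP => ab'.
  have /eqP := @zeta_neq1 (2 * (b - a)) ltac:(lia); apply.
  apply: (mulfI (expf_neq0 (2 * a) w0)); rewrite mulr1 -exprD ab'.
  by congr (_ ^+ _); lia.
case: (ltngtP j k) jk => // lt _.
  by have := aux j k; rewrite lt kp E eqxx => /(_ isT).
by have := aux k j; rewrite lt jp E eqxx => /(_ isT).
Qed.

(** Each P k is transported to the k-th sphere and cut off by [piece k]. *)
Lemma glue_polynomials (P : nat -> mpoly n C) : exists Q, forall k x,
  (k < p)%N -> S x -> ceval Q (rot k x) = reval (P k) x.
Proof.
have /choice[P' P'E] := fun k => reval_ceval_phase (P k) k.
exists (\sum_(k < p) piece k * P' k) => j x jp Sx.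
rewrite /ceval raddf_sum /= (bigD1 (Ordinal jp))//= big1 ?addr0.
  rewrite -[meval _ _]/(ceval (piece j * P' j) (rot j x)) cevalM ceval_piece//.
  by rewrite eqxx mul1r P'E.
move=> k kj; rewrite -[meval _ _]/(ceval (piece k * P' k) (rot j x)) cevalM.
rewrite ceval_piece// (_ : (j == k) = false) ?mul0r//.
by apply/negbTE; rewrite eq_sym; exact: kj.
Qed.

Lemma Rintegral_sum (I : Type) (r : seq I) (g : I -> V -> R) :
  (forall k, intg mu S (g k)) -> Rintegral mu S (fun x => \sum_(k <- r) g k x) =
  \sum_(k <- r) Rintegral mu S (g k).
Proof.
move=> gi; elim: r => [|k r IH].
  rewrite big_nil; under eq_Rintegral do rewrite big_nil.
  by rewrite Rintegral_cst ?mul0r.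
rewrite big_cons -IH -RintegralD; [|exact: mS|exact: gi|exact: intg_sum].
by apply: eq_Rintegral => x _; rewrite big_cons.
Qed.

(** Approximate f by polynomials on each sphere, glue them, and rewrite the
    result on the rotated spheres as a sum of spherical polyharmonics. *)
Lemma spherical_dense f (e : R) : (0 < n)%N -> L2 p f -> 0 < e ->
  exists N (w : nat -> F), (forall m, H m (w m)) /\
    hnorm ip (f - \sum_(0 <= m < N) w m) < e.
Proof.
move=> n0 /L2P fi e0; have e2 : 0 < e ^+ 2 / 2 by rewrite divr_gt0// exprn_gt0.
have /choice[P PE] : forall k : nat, exists u, (k < p)%N ->
    csqint (fun x => f (rot k x) - reval u x) /\
    Rintegral mu S (fun x : V => complex.Re `|f (rot k x) - reval u x| ^+ 2) <
      e ^+ 2 / 2.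
  move=> k; have [kp|//] := boolP (k < p)%N; last by exists 0.
  by have [u uP] := complex_poly_dense (fi k kp) e2; exists u.
have [Q QE] := glue_polynomials P.
have [N [w [Hw Qw]]] := spherical_span_ceval Q n0.
exists N, w; split => //; set d := f - _.
have dE (k : 'I_p) x : S x -> d (rot k x) = f (rot k x) - reval (P k) x.
  move=> Sx; rewrite -(QE k x (ltn_ord k) Sx).
  rewrite Qw; last by exists (k : nat); [exact: ltn_ord|exists x].
  by rewrite /d -[LHS]/(_ - _) fct_sumE.
rewrite /hnorm Re_L2_inner -[ltRHS]gtr0_norm// -sqrtr_sqr ltr_sqrt ?exprn_gt0//.
have -> : Rintegral mu S (sumsq d : V -> R) = \sum_(k < p)
    Rintegral mu S (fun x : V => complex.Re `|f (rot k x) - reval (P k) x| ^+ 2).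
  rewrite -Rintegral_sum.
    by apply: eq_Rintegral => x /set_mem Sx; apply: eq_bigr => k _; rewrite dE.
  move=> k; under eq_fun do rewrite Re_normc2.
  by have [[[_ i1] [_ i2]] _] := PE k (ltn_ord k); exact: (intgD mS).
apply: (@le_lt_trans _ _ (e ^+ 2 / 2)); last first.
  by rewrite ltr_pdivrMr// ltr_pMr ?exprn_gt0// ltr1n.
rewrite mulrC ler_pdivrMr ?ltr0n// mulr_natr -[p in leRHS]card_ord -sumr_const.
by apply: ler_sum => k _; have [_ /ltW] := PE k (ltn_ord k).
Qed.

End rotated.

Theorem theorem1 (R : realType) (p n : nat) (hp : (1 <= p)%N) (hn : (2 <= n)%N) :
  hilbert_direct_sum (@L2 R n p) (@L2_eq R n p) (@L2_inner R n p)
    (fun m => @spherical_polyharmonic R n p m).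
Proof.
apply: (direct_sum_criterion (@L2_0 R n p) (@L2_linear R n p)
  (@L2_inner_linear R n p) (@L2_inner_conj R n p) (@L2_inner_ge0 R n p)).
- by move=> x y; exact: L2_null.
- by move=> m; exact: spherical_L2.
- by move=> m; exact: spherical_linear.
- by move=> m x; exact: spherical_proj.
- by move=> m k; exact: spherical_orthogonal.
- by move=> x e; apply: spherical_dense => //; exact: ltnW.
Qed.
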